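(* Let $\mathcal{H}$ be a finite-dimensional complex Hilbert space and let $(N_t)_{t\ge 0}$ be a differentiable family of completely positive linear maps $N_t:\mathcal{B}(\mathcal{H})\to\mathcal{B}(\mathcal{H})$ of the form $$N_t=\mathrm{id}-\int_0^t F_\tau\,d\tau ,\qquad t\ge 0,$$ where $F_t=-\dot N_t$ (in particular $N_0=\mathrm{id}$). Suppose that $F_t^{\#}\mathbb{I}\ge 0$ for all $t\ge 0$. Then there exists a family $(Q_t)_{t\ge 0}$ of completely positive linear maps $Q_t:\mathcal{B}(\mathcal{H})\to\mathcal{B}(\mathcal{H})$ satisfying $$Q_t^{\#}\mathbb{I}=F_t^{\#}\mathbb{I}\qquad\text{for all } t\ge 0,$$ and such that the formula $$\widetilde{\mathcal{K}}_s=\bigl[\widetilde{Q}_s-(\mathrm{id}-s\,\widetilde{N}_s)\bigr]\,\widetilde{N}_s^{-1}$$ (for all sufficiently large real $s$) defines the Laplace transform of a legitimate memory kernel. That is, there is a continuous family $(\Lambda_t)_{t\ge 0}$ of completely positive trace-preserving linear maps on $\mathcal{B}(\mathcal{H})$ with $\Lambda_0=\mathrm{id}$ which solves the memory-kernel master equation with kernel $\mathcal{K}$, in the sense that for all sufficiently large real $s$ $$\widetilde{\Lambda}_s=\bigl(s\,\mathrm{id}-\widetilde{\mathcal{K}}_s\bigr)^{-1}.$$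
   Context: $\mathcal{B}(\mathcal{H})$ is the space of linear operators on $\mathcal{H}$, $\mathbb{I}$ is the identity operator on $\mathcal{H}$, and $\mathrm{id}$ is the identity map on $\mathcal{B}(\mathcal{H})$. Products and inverses of linear maps on $\mathcal{B}(\mathcal{H})$ mean composition and compositional inverse. For a linear map $K:\mathcal{B}(\mathcal{H})\to\mathcal{B}(\mathcal{H})$, the dual $K^{\#}$ is defined by $\mathrm{Tr}\bigl((K^{\#}a)\,b\bigr)=\mathrm{Tr}\bigl(a\,(Kb)\bigr)$ for all $a,b\in\mathcal{B}(\mathcal{H})$. Thus $K$ is trace preserving iff $K^{\#}\mathbb{I}=\mathbb{I}$. For operators, $a\ge 0$ means positive semidefinite. For a family of maps $(A_t)_{t\ge0}$, the Laplace transform is $\widetilde{A}_s=\int_0^\infty e^{-st}A_t\,dt$. The memory-kernel (non-Markovian) master equation with kernel $\mathcal{K}$ is $$\frac{d}{dt}\Lambda_t=\int_0^t\mathcal{K}_{t-\tau}\Lambda_\tau\,d\tau,\qquad \Lambda_0=\mathrm{id}.$$ The kernel is specified through its Laplace transform $\widetilde{\mathcal{K}}_s$ and may contain delta-type terms (e.g. $\mathcal{K}_\tau=2\delta(\tau)L$ reproduces the semigroup equation $\dot\Lambda_t=L\Lambda_t$). The equation is therefore understood in the Laplace domain, where it reads $\widetilde{\Lambda}_s=(s\,\mathrm{id}-\widetilde{\mathcal{K}}_s)^{-1}$. The kernel is called legitimate (a legitimate generator of a non-Markovian dynamical map) if its solution $\Lambda_t$ is completely positive and trace preserving for every $t\ge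 0$. *)

(* Defs.v *)
From HB Require Import structures.
From mathcomp Require Import all_boot all_order all_algebra.
From mathcomp Require Import complex.
From mathcomp Require Import all_classical all_reals all_analysis.
Set Implicit Arguments.
Unset Strict Implicit.
Unset Printing Implicit Defensive.
Import Order.TTheory GRing.Theory Num.Theory.
Import numFieldNormedType.Exports.
Local Open Scope classical_set_scope.
Local Open Scope ring_scope.
Local Open Scope complex_scope.

(* The finite-dimensional Hilbert space is C^n with C = R[i], so that
   B(H) is 'M[R[i]]_n and linear maps on B(H) are 'End('M[R[i]]_n), with
   composition, identity and inverse in the scope lfun_scope (%VF). *)
Notation superop R n := 'End('M[R[i]]_n).

Section Positivity.
Variables (R : realType) (n : nat).

(* The order of R[i] is such that 0 <= z means that z is real and nonnegative;
   in particular a psd matrix is Hermitian. *)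
Definition psd m (A : 'M[R[i]]_m) : Prop :=
  forall v : 'cV[R[i]]_m, 0 <= (map_mx conjc v^T *m A *m v) 0 0.

(* The ampliation id_k (x) K, where M_k (x) B(H) is seen as the k x k block
   matrices with blocks in B(H). *)
Definition ampliation (k : nat) (K : superop R n)
    (A : 'M[R[i]]_(\sum_(i < k) n)) : 'M[R[i]]_(\sum_(i < k) n) :=
  \mxblock_(i < k, j < k) K (submxblock A i j).

Definition completely_positive (K : superop R n) : Prop :=
  forall (k : nat) (A : 'M[R[i]]_(\sum_(i < k) n)),
    psd A -> psd (ampliation K A).

Definition trace_preserving (K : superop R n) : Prop :=
  forall a, \tr (K a) = \tr a.

(* Entry (i, j) of K^# a is \tr (K^# a *m delta_mx j i); dualP and dual_unique
   show that this is the map determined by the trace pairing. *)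
Definition dual (K : superop R n) : superop R n :=
  linfun (fun a => \matrix_(i, j) \tr (a *m K (delta_mx j i))).

Let dual_fun (K : superop R n) (a : 'M[R[i]]_n) : 'M[R[i]]_n :=
  \matrix_(i, j) \tr (a *m K (delta_mx j i)).

Let dual_fun_is_linear K : linear (dual_fun K).
Proof.
move=> c a b; apply/matrixP => i j.
by rewrite !mxE mulmxDl -scalemxAl mxtraceD mxtraceZ.
Qed.

Let mxtrace_mul_delta (a : 'M[R[i]]_n) i j : \tr (a *m delta_mx j i) = a i j.
Proof.
rewrite /mxtrace (bigD1 i)//= big1 ?addr0 => [|k ki].
  rewrite mxE (bigD1 j)//= big1 ?addr0 => [|k kj].
    by rewrite mxE !eqxx mulr1.
  by rewrite mxE (negbTE kj) mulr0.
by rewrite mxE big1// => l _; rewrite mxE (negbTE ki) andbF mulr0.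
Qed.

Lemma dualP (K : superop R n) a b : \tr (dual K a *m b) = \tr (a *m K b).
Proof.
pose L := GRing.isLinear.Build _ _ _ _ _ (dual_fun_is_linear K).
pose g : {linear 'M[R[i]]_n -> 'M[R[i]]_n} := HB.pack (dual_fun K) L.
have -> : dual K a = dual_fun K a by exact: (lfunE g).
rewrite (matrix_sum_delta b) mulmx_sumr (linear_sum K) mulmx_sumr.
rewrite !(linear_sum (@mxtrace _ _)); apply: eq_bigr => i _ /=.
rewrite mulmx_sumr (linear_sum K) mulmx_sumr.
rewrite !(linear_sum (@mxtrace _ _)); apply: eq_bigr => j _ /=.
by rewrite [K _]linearZ -!scalemxAr !mxtraceZ mxtrace_mul_delta mxE.
Qed.

Lemma dual_unique (K L : superop R n) :
  (forall a b, \tr (L a *m b) = \tr (a *m K b)) -> L = dual K.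
Proof.
move=> LK; apply/lfunP => a; apply/matrixP => i j.
by rewrite -[LHS]mxtrace_mul_delta -[RHS]mxtrace_mul_delta LK dualP.
Qed.

End Positivity.

(* Analytic notions for families of maps are understood for all the real and
   imaginary parts of the entries t |-> (A t a) i j; the topology of the
   finite-dimensional real vector space of linear maps on B(H) is the one of
   coordinatewise convergence. *)
Section Calculus.
Variables (R : realType) (n : nat).
Local Notation mu := (@lebesgue_measure R).
Implicit Types (A B : R -> superop R n) (D : set R).

Definition halfline : set R := `[0, +oo[%classic.

Definition real_coords (P : (R -> R) -> Prop) A : Prop :=
  forall a i j, P (fun t => complex.Re (A t a i j)) /\ P (fun t => complex.Im (A t a i j)).

(* The derivative of f on [0, +oo[ is df; at 0 it is the right derivative. *)
Definition has_deriv_halfline (f df : R -> R) : Prop :=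
  forall t, 0 <= t ->
    (f (t + h) - f t) / h @[h --> within [set h | 0 <= t + h] 0^'] --> df t.

Definition map_has_deriv A B : Prop :=
  forall a i j,
    has_deriv_halfline (fun t => complex.Re (A t a i j)) (fun t => complex.Re (B t a i j)) /\
    has_deriv_halfline (fun t => complex.Im (A t a i j)) (fun t => complex.Im (B t a i j)).

Definition map_continuous A : Prop :=
  real_coords (fun f => {within halfline, continuous f}) A.

Definition map_integrable D A : Prop :=
  real_coords (fun f => mu.-integrable D (EFin \o f)) A.

(* linfun f is the linear map which agrees with f on the matrix units;
   map_integralE shows that it agrees with f everywhere here. *)
Definition map_integral D A : superop R n :=
  linfun (fun a => \matrix_(i, j)
    ((\int[mu]_(t in D) complex.Re (A t a i j)) +i* (\int[mu]_(t in D) complex.Im (A t a i j)))).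

Definition laplace_integrand A (s : R) : R -> superop R n :=
  fun t => (expR (- (s * t)))%:C *: A t.

Definition laplace_converges A (s : R) : Prop :=
  map_integrable halfline (laplace_integrand A s).

Definition laplace A (s : R) : superop R n :=
  map_integral halfline (laplace_integrand A s).

Let map_integral_fun D A (a : 'M[R[i]]_n) : 'M[R[i]]_n := \matrix_(i, j)
  ((\int[mu]_(t in D) complex.Re (A t a i j)) +i* (\int[mu]_(t in D) complex.Im (A t a i j))).

Let integrableZ D (f : R -> R) c : @measurable _ (measurableTypeR R) D ->
  mu.-integrable D (EFin \o f) -> mu.-integrable D (EFin \o (fun t => c * f t)).
Proof.
move=> mD If; have := integrableZl mD c If; apply: eq_integrable mD _ _ _ => t _.
by rewrite /= EFinM.
Qed.

Let map_integral_fun_is_linear D A : @measurable _ (measurableTypeR R) D -> map_integrable D A ->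
  linear (map_integral_fun D A).
Proof.
move=> mD IA c a b; apply/matrixP => i j; rewrite !mxE.
have [ra ia] := IA a i j; have [rb ib] := IA b i j.
case: c => cr ci; rewrite /GRing.mul/= /GRing.add/=.
have E t : A t ((cr +i* ci) *: a + b) i j =
   (cr * complex.Re (A t a i j) - ci * complex.Im (A t a i j) + complex.Re (A t b i j)) +i*
   (cr * complex.Im (A t a i j) + ci * complex.Re (A t a i j) + complex.Im (A t b i j)).
  by rewrite linearP !mxE; case: (A t a i j) => x y; case: (A t b i j).
congr (_ +i* _).
- under eq_Rintegral do rewrite E /=.
  rewrite RintegralD//; last first.
    have := integrableB mD (integrableZ cr mD ra) (integrableZ ci mD ia).
    by apply: eq_integrable.
  by rewrite RintegralB ?RintegralZl//; exact: integrableZ.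
- under eq_Rintegral do rewrite E /=.
  rewrite RintegralD//; last first.
    have := integrableD mD (integrableZ cr mD ia) (integrableZ ci mD ra).
    by apply: eq_integrable.
  by rewrite RintegralD ?RintegralZl//; exact: integrableZ.
Qed.

Lemma map_integralE D A a i j : @measurable _ (measurableTypeR R) D -> map_integrable D A ->
  map_integral D A a i j =
  (\int[mu]_(t in D) complex.Re (A t a i j)) +i* (\int[mu]_(t in D) complex.Im (A t a i j)).
Proof.
move=> mD IA.
pose L := GRing.isLinear.Build _ _ _ _ _ (map_integral_fun_is_linear mD IA).
pose g : {linear 'M[R[i]]_n -> 'M[R[i]]_n} := HB.pack (map_integral_fun D A) L.
have -> : map_integral D A a = map_integral_fun D A a by exact: (lfunE g).
by rewrite mxE.
Qed.

End Calculus.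

Section MemoryKernel.
Variables (R : realType) (n : nat).
Implicit Types N Q Lam K : R -> superop R n.

Definition invertible_map (L : superop R n) : Prop := lker L == 0%VS.

(* Kernels are given by their Laplace transforms s |-> K s, s real. *)
Definition memory_kernel N Q : R -> superop R n := fun s =>
  ((laplace Q s - (\1 - s%:C *: laplace N s)) \o (laplace N s)^-1)%VF.

Definition solves_master_equation K Lam : Prop :=
  Lam 0 = \1%VF /\
  \forall s \near +oo,
    [/\ laplace_converges Lam s,
        invertible_map (s%:C *: \1%VF - K s) &
        laplace Lam s = ((s%:C *: \1 - K s)^-1)%VF].

Definition legitimate_kernel K : Prop :=
  exists Lam : R -> superop R n,
    [/\ map_continuous Lam,
        forall t, 0 <= t ->
          completely_positive (Lam t) /\ trace_preserving (Lam t) &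
        solves_master_equation K Lam].

End MemoryKernel.

(* Main.v *)
Require Import Defs.
From HB Require Import structures.
From mathcomp Require Import all_boot all_order all_algebra.
From mathcomp Require Import complex.
From mathcomp Require Import all_classical all_reals all_analysis.
From mathcomp Require Import spectral sesquilinear measurable_realfun.
From mathcomp Require Import ring lra.
Set Implicit Arguments.
Unset Strict Implicit.
Unset Printing Implicit Defensive.
Import Order.TTheory GRing.Theory Num.Theory.
Import numFieldNormedType.Exports.
Local Open Scope classical_set_scope.
Local Open Scope ring_scope.

(* Let w be the maximally mixed state and f_t(a) = tr(F_t a), and take
   Q_t(a) = f_t(a) w, which is completely positive because F_t^# 1 >= 0.  Since
   s - K~_s = (1 - Q~_s) N~_s^-1, a solution is a family Lam with
   Lam~ (1 - Q~) = N~, that is Lam = N + Lam * Q (convolution in time).  As Q_t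
   has rank one, this reduces to the scalar-kernel renewal equation
   M = N(w) + g * M for M = Lam(w), where g_t = f_t(w) >= 0 has total mass at
   most 1, and then Lam_t(a) = N_t(a) + \int_0^t f_u(a) M_(t-u) du.  Picard
   iteration with the weight exp t solves the equation, because
   \int g_u exp(-u) du < 1; the same contraction estimate shows that solutions
   with positive data are positive, whence M_t >= 0, and that tr M = 1.  Finally
   s N~_s -> 1 as s -> +oo, so that N~_s is invertible for large s. *)

(** * Convolutions and Laplace transforms on the half-line *)

Section Segments.
Variable R : realType.
Local Notation mu := (@lebesgue_measure R).
Local Notation hl := (@halfline R).
Implicit Types (f g h x y : R -> R) (s t q B C : R).

(** The total mass of g is 1 minus the limit of tr N_t(w), so it may equal 1 and convolution with g
    need not contract the plain sup norm. The weight exp(-t) restores strictness, and the growth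
    bound C exp t that comes with it is what makes the Laplace transforms converge for s > 1.
    Integrability of tr(F_t a) over the whole half-line is not part of the data. For a psd it is
    extracted from 0 <= tr N_t(a) <= tr a, and it extends to every a because psd matrices span. The
    same inequalities bound N_t uniformly in t. One comparison principle serves twice: applied to a
    solution with positive data it gives positivity, applied to both signs of a solution of the
    homogeneous equation it gives uniqueness. On the Laplace side a one-sided identity suffices: a
    left inverse of an endomorphism in finite dimension is its inverse, so 1 - Q~ is never inverted
    separately. *)

Definition conv g x t : R := \int[mu]_(u in `[0, t]) (g u * x (t - u)).

Lemma measurable_halfline : measurable (hl : set (measurableTypeR R)).
Proof. exact: measurable_itv. Qed.

(** The data are constrained for t >= 0 only. Precomposing with [Num.max t 0] freezes a function at
    its value in 0 and lets continuity be stated on the whole line. *)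
Lemma max0_continuous : continuous (fun t : R => Num.max t 0).
Proof.
by move=> t; apply: (@continuous_max _ _ (fun t : R => t) (cst 0) t); [exact: cvg_id|exact: cvg_cst].
Qed.

Lemma within_continuous_comp (A : set R) f (k : R -> R) :
  {within A, continuous f} -> continuous k -> (forall t, A (k t)) ->
  continuous (f \o k).
Proof.
move=> /subspace_continuousP cf ck Ak t.
apply: cvg_comp; last exact: cf _ (Ak t).
move=> W; rewrite /within/= => kW.
have AW : \forall z \near t, A (k z) -> W (k z) := ck t _ kW.
suff : \forall z \near t, W (k z) by [].
by apply: filterS AW => z /(_ (Ak z)).
Qed.

Lemma within_halfline_continuous f g :
  continuous f -> (forall t, 0 <= t -> f t = g t) -> {within hl, continuous g}.
Proof.
move=> cf fg.
apply: (@subspace_eq_continuous _ hl _ f); last exact: continuous_subspaceT.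
by move=> t; rewrite inE /halfline /= in_itv/= andbT => /fg.
Qed.

Lemma bounded_on_segment f a b : continuous f ->
  exists2 B, 0 <= B & forall t, a <= t <= b -> `|f t| <= B.
Proof.
move=> cf; have [ab|ba] := leP a b; last first.
  by exists 0 => // t /andP[at_ tb]; have := le_trans at_ tb; rewrite leNgt ba.
have cnf : {within `[a, b], continuous (fun t => `|f t|)}.
  apply: continuous_subspaceT => t; apply: continuous_comp; first exact: cf.
  exact: norm_continuous.
have [c _ cP] := EVT_max ab cnf.
by exists `|f c| => // t tab; apply: cP; rewrite in_itv.
Qed.

Lemma integrable_mul_bounded (D : set R) g x B :
  measurable (D : set (measurableTypeR R)) ->
  mu.-integrable D (EFin \o g) ->
  measurable_fun (D : set (measurableTypeR R)) x -> (forall u, D u -> `|x u| <= B) ->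
  mu.-integrable D (EFin \o (fun u => g u * x u)).
Proof.
move=> mD ig mx xB.
have B0 u : D u -> 0 <= B by move=> /xB; exact: le_trans.
have := integrableZl mD B ig.
apply: le_integrable => //=.
  apply/measurable_EFinP; apply: measurable_funM => //.
  by apply/measurable_EFinP; exact: measurable_int ig.
by move=> u Du; rewrite lee_fin !normrM mulrC (ger0_norm (B0 _ Du)) ler_wpM2r ?xB.
Qed.

Lemma continuous_shift x t : continuous x -> continuous (fun u => x (t - u)).
Proof.
move=> cx u; apply: continuous_comp; last exact: cx.
by apply: cvgB; [exact: cvg_cst|exact: cvg_id].
Qed.

Lemma conv_integrable g x t : continuous x ->
  mu.-integrable `[0, t] (EFin \o g) ->
  mu.-integrable `[0, t] (EFin \o (fun u => g u * x (t - u))).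
Proof.
move=> cx ig; have cs := @continuous_shift x t cx.
have [B _ xB] := bounded_on_segment 0 t cs.
apply: (@integrable_mul_bounded _ _ _ B) => //=.
by apply: measurable_funTS; exact: continuous_measurable_fun.
Qed.

Lemma integrable_halflineS g t :
  mu.-integrable hl (EFin \o g) -> mu.-integrable `[0, t] (EFin \o g).
Proof.
apply: integrableS => //; first exact: measurable_halfline.
by move=> u; rewrite /halfline /= !in_itv/= andbT => /andP[].
Qed.

Lemma continuous_integral_max0 g :
  (forall t, 0 <= t -> mu.-integrable `[0, t] (EFin \o g)) ->
  continuous (fun t => \int[mu]_(u in `[0, Num.max t 0]) g u).
Proof.
move=> ig t.
pose b := Num.max t 0 + 1.
have b0 : 0 <= b by rewrite addr_ge0// le_max lexx orbT.
have cG := parameterized_integral_continuous b0 (ig _ b0).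
(* The clamp sends the whole line into [0, b], where the primitive is known to be continuous. Since
   b exceeds [Num.max t 0] by 1, it agrees with [Num.max z 0] for z near t. *)
pose k := fun t : R => Num.min (Num.max t 0) b.
have ck : continuous k.
  move=> z; apply: (@continuous_min _ _ (fun t : R => Num.max t 0) (cst b) z).
    exact: max0_continuous.
  exact: cvg_cst.
have Ak z : `[0, b]%classic (k z).
  by rewrite /= in_itv/= /k le_min le_max lexx orbT b0 ge_min lexx orbT.
have := within_continuous_comp cG ck Ak => /(_ t).
rewrite /continuous_at.
have kt z : z < b -> k z = Num.max z 0.
  by move=> zb; rewrite /k min_l// ge_max b0 ltW.
rewrite /= kt; last by rewrite /b ltr_pwDr// le_max lexx.
apply: cvg_trans; apply: near_eq_cvg.
near=> z; rewrite /= kt//; near: z; apply: lt_nbhsl.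
by rewrite /b ltr_pwDr// le_max lexx.
Unshelve. all: by end_near. Qed.

End Segments.

Section ConvolutionBounds.
Variable R : realType.
Local Notation mu := (@lebesgue_measure R).
Local Notation hl := (@halfline R).
Implicit Types (f g h x y : R -> R) (s t q B C : R).

Lemma integrable_scale (D : set R) f c :
  measurable (D : set (measurableTypeR R)) -> mu.-integrable D (EFin \o f) ->
  mu.-integrable D (EFin \o (fun u => c * f u)).
Proof. by move=> mD /(integrableZl mD c); apply: eq_integrable. Qed.

Lemma Rintegral_subset (D E : set R) f :
  measurable (D : set (measurableTypeR R)) ->
  measurable (E : set (measurableTypeR R)) ->
  D `<=` E -> mu.-integrable E (EFin \o f) -> (forall u, E u -> 0 <= f u) ->
  \int[mu]_(u in D) f u <= \int[mu]_(u in E) f u.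
Proof.
move=> mD mE DE iE f0; rewrite /Rintegral fine_le//.
- by apply: integrable_fin_num => //; exact: integrableS iE.
- exact: integrable_fin_num.
- by apply: ge0_subset_integral => //; exact: measurable_int iE.
Qed.

(** The contraction estimate. Since exp(t - u) = exp t * exp(-u), convolution with g multiplies a
    bound in the norm sup |x u| exp(-u) by at most the Laplace transform of |g| at 1. Only the
    values of x on [0, t] enter. *)
Lemma conv_bound g x D t : mu.-integrable hl (EFin \o g) -> continuous x ->
  0 <= t -> (forall u, 0 <= u <= t -> `|x u| <= D * expR u) ->
  `|conv g x t| <= D * (\int[mu]_(u in hl) (`|g u| * expR (- u))) * expR t.
Proof.
move=> ig cx t0 xD.
have mhl := @measurable_halfline R.
have D0 : 0 <= D.
  have := xD 0; rewrite lexx t0 expR0 mulr1 => /(_ isT); exact: le_trans.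
have ie : mu.-integrable hl (EFin \o (fun u => `|g u| * expR (- u))).
  apply: (@integrable_mul_bounded _ _ _ _ 1) => //.
  - exact: integrable_norm.
  - apply: measurable_funTS; apply: continuous_measurable_fun => u.
    by apply: continuous_comp; [exact: continuousN|exact: continuous_expR].
  - move=> u; rewrite /halfline/= in_itv/= andbT => u0.
    by rewrite ger0_norm ?expR_ge0// expR_le1// oppr_le0.
have ic := conv_integrable cx (integrable_halflineS t ig).
apply: le_trans (le_normr_Rintegral _ ic) _ => //.
rewrite mulrAC -RintegralZl//.
apply: (@le_trans _ _ (\int[mu]_(u in `[0, t]) (D * expR t * (`|g u| * expR (- u))))).
  apply: le_Rintegral => //.
  - exact: (integrable_norm ic).
  - by apply: integrable_scale => //; exact: integrable_halflineS.
  - move=> u /=; rewrite in_itv/= => /andP[u0 ut].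
    rewrite normrM mulrCA ler_wpM2l// -mulrA -expRD xD//.
    by rewrite subr_ge0 ut gerBl.
apply: Rintegral_subset => //.
- by move=> u; rewrite /halfline/= !in_itv/= andbT => /andP[].
- exact: integrable_scale.
- by move=> u _; rewrite !mulr_ge0 ?expR_ge0.
Qed.

Lemma convB g x y t : mu.-integrable hl (EFin \o g) -> continuous x -> continuous y ->
  conv g x t - conv g y t = conv g (x \- y) t.
Proof.
move=> /(integrable_halflineS t) ig cx cy; rewrite /conv -RintegralB//.
- by apply: eq_Rintegral => u _; rewrite /= mulrBr.
- exact: conv_integrable.
- exact: conv_integrable.
Qed.

Lemma conv_continuous g x : mu.-integrable hl (EFin \o g) -> continuous x ->
  continuous (fun t => conv g x (Num.max t 0)).
Proof.
move=> ig cx.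
have mhl := @measurable_halfline R.
(* X vanishes on the left of 0 and is continuous, so that [fun t => X (t - u)]
   can be integrated over a domain that does not depend on t. *)
pose X u := x (Num.max u 0) - x 0.
have cX : continuous X.
  move=> u; apply: cvgB; last exact: cvg_cst.
  by apply: (@continuous_comp _ _ _ (fun u : R => Num.max u 0)); [exact: max0_continuous|exact: cx].
pose H t := \int[mu]_(u in hl) (g u * X (t - u)).
have X_ub t B u : (forall z, 0 <= z <= Num.max t 0 -> `|X z| <= B) -> 0 <= B ->
    0 <= u -> `|X (t - u)| <= B.
  move=> XB B0 u0; have [tu|tu] := leP (t - u) 0.
    by rewrite /X max_r// subrr normr0.
  by apply: XB; rewrite ltW//= le_max gerBl u0.
have mX t : measurable_fun (hl : set (measurableTypeR R)) (fun u => X (t - u)).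
  by apply: measurable_funTS; apply: continuous_measurable_fun; exact: continuous_shift.
have cH : continuous H.
  move=> t.
  have [B B0 XB] := bounded_on_segment 0 (Num.max (t + 1) 0) cX.
  apply: (@continuity_under_integral _ _ _ mu (fun t u => g u * X (t - u)) hl mhl
     (t - 1) (t + 1) _ _ (fun u => B * `|g u|)).
  - move=> z _.
    have [B' B'0 XB'] := bounded_on_segment 0 (Num.max z 0) cX.
    apply: (@integrable_mul_bounded _ _ _ _ B') => //.
    by move=> u; rewrite /halfline/= in_itv/= andbT; exact: X_ub.
  - apply: aeW => u _ z _; apply: cvgM; first exact: cvg_cst.
    apply: (@continuous_comp _ _ _ (fun z => z - u)); last exact: cX.
    by apply: cvgB; [exact: cvg_id|exact: cvg_cst].
  - by apply: integrable_scale => //; exact: integrable_norm.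
  - move=> z; rewrite /= in_itv/= => /andP[_ zt]; apply: aeW => u.
    rewrite /halfline/= in_itv/= andbT normrM mulrC => u0.
    rewrite ler_wpM2r//; apply: X_ub => // v /andP[v0 vz]; apply: XB.
    rewrite v0 (le_trans vz)// ge_max !le_max lexx orbT andbT.
    by rewrite (ltW zt).
  - by rewrite inE/= in_itv/= gtrDl ltrDl ltr01 andbT oppr_lt0 ltr01.
(* Undoing the subtraction of [x 0] in [X] costs [x 0] times the primitive of g, which is continuous
   on its own. *)
have HE t : 0 <= t -> conv g x t = H t + x 0 * \int[mu]_(u in `[0, t]) g u.
  move=> t0.
  have -> : H t = \int[mu]_(u in `[0, t]) (g u * x (t - u) - x 0 * g u).
    rewrite /H (_ : `[0, t]%classic = hl `&` `[0, t]%classic); last first.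
      rewrite setIidr// => u; rewrite /halfline/= !in_itv/= andbT.
      by move=> /andP[].
    rewrite Rintegral_mkcondr; apply: eq_Rintegral => u.
    rewrite inE /halfline/= in_itv/= andbT => u0.
    rewrite patchE mem_setE in_itv/= u0/=; case: ifPn => ut.
      by rewrite /X max_l ?subr_ge0//; ring.
    by rewrite /X max_r ?subrr ?mulr0// subr_le0 ltW// ltNge.
  have ig' := integrable_halflineS t ig.
  rewrite RintegralB//; last 2 first.
  - exact: conv_integrable.
  - exact: integrable_scale.
  by rewrite RintegralZl// subrK.
rewrite (_ : (fun t => _) = fun t => H (Num.max t 0) +
   x 0 * \int[mu]_(u in `[0, Num.max t 0]) g u); last first.
  by apply/funext => t; rewrite HE// le_max lexx orbT.
move=> t; apply: cvgD.
  by apply: (@continuous_comp _ _ _ (fun u : R => Num.max u 0)); [exact: max0_continuous|exact: cH].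
apply: cvgM; first exact: cvg_cst.
by apply: continuous_integral_max0 => z _; exact: integrable_halflineS.
Qed.

End ConvolutionBounds.

(** * Scalar Volterra equations of the second kind: existence and positivity *)

Section Volterra.
Variable R : realType.
Local Notation mu := (@lebesgue_measure R).
Local Notation hl := (@halfline R).
Implicit Types (f g h x y : R -> R) (s t q B C : R).

Lemma geometric_squeeze q C (z : R) : 0 <= q < 1 -> (forall k, `|z| <= C * q ^+ k) -> z = 0.
Proof.
move=> /andP[q0 q1] zC; apply/eqP; rewrite -normr_le0.
have : (fun k => C * q ^+ k) @ \oo --> C * 0.
  by apply: cvgM; [exact: cvg_cst|apply: cvg_expr; rewrite ger0_norm].
rewrite mulr0 => cv; rewrite -(cvg_lim (@Rhausdorff R) cv).
by apply: limr_ge; [apply/cvg_ex; exists 0|exact: nearW].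
Qed.

(** With D = B / (1 - q) one has B = D - D q, which makes u k - D q^k nondecreasing and u k + D q^k
    nonincreasing. These sequences are adjacent, and their common limit lies between them, which is
    the stated rate. *)
Lemma geometric_cauchy_limit (u : R ^nat) q B : 0 <= q < 1 ->
  (forall k, `|u k.+1 - u k| <= B * q ^+ k) ->
  exists l, forall k, `|l - u k| <= B / (1 - q) * q ^+ k.
Proof.
move=> /andP[q0 q1] uB; pose D := B / (1 - q).
have BD : B = D - D * q.
  by rewrite -{1}[D]mulr1 -mulrBr /D divfK// gt_eqF// subr_gt0.
pose lo k := u k - D * q ^+ k; pose up k := u k + D * q ^+ k.
have nlo : nondecreasing_seq lo.
  apply/nondecreasing_seqP => k; rewrite /lo exprS.
  by move: (uB k); rewrite BD ler_norml => /andP[+ _]; lra.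
have nup : nonincreasing_seq up.
  apply/nonincreasing_seqP => k; rewrite /up exprS.
  by move: (uB k); rewrite BD ler_norml => /andP[_ +]; lra.
have d0 : up - lo @ \oo --> 0.
  rewrite (_ : up - lo = fun k => 2 * D * q ^+ k); last first.
    by apply/funext => k; rewrite /up /lo !fctE; ring.
  rewrite -(mulr0 (2 * D)).
  by apply: cvgM; [exact: cvg_cst|apply: cvg_expr; rewrite ger0_norm].
have [E clo cup] := adjacent_seq nlo nup d0.
exists (limn lo) => k; rewrite ler_norml.
have /(_ k) h1 := nondecreasing_cvgn_le nlo clo.
have /(_ k) h2 := nonincreasing_cvgn_ge nup cup.
move: h1 h2; rewrite E /lo /up -/D; lra.
Qed.

Lemma volterra_exists g f B :
  mu.-integrable hl (EFin \o g) ->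
  \int[mu]_(u in hl) (`|g u| * expR (- u)) < 1 ->
  continuous f -> (forall t, 0 <= t -> `|f t| <= B * expR t) ->
  exists x, [/\ continuous x,
    exists C, forall t, 0 <= t -> `|x t| <= C * expR t &
    forall t, 0 <= t -> x t = f t + conv g x t].
Proof.
move=> ig; set q := Rintegral _ _ _ => q1 cf fB.
have q0 : 0 <= q by apply: Rintegral_ge0 => u _; rewrite mulr_ge0 ?expR_ge0.
have q01 : 0 <= q < 1 by rewrite q0.
have B0 : 0 <= B by have := fB 0 (lexx _); rewrite expR0 mulr1; exact: le_trans.
pose m t : R := Num.max t 0.
have m0 t : 0 <= m t by rewrite le_max lexx orbT.
have mE t : 0 <= t -> m t = t by move=> ?; rewrite /m max_l.
(* For t >= 0 this is the right-hand side of the equation; the argument [m t] keeps all Picard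
   iterates continuous on the whole line. *)
pose T x t := f (m t) + conv g x (m t).
pose xs k := iter k T (cst 0).
have cT x : continuous x -> continuous (T x).
  move=> cx t; apply: cvgD; last exact: conv_continuous.
  by apply: (@continuous_comp _ _ _ (fun u : R => Num.max u 0)); [exact: max0_continuous|exact: cf].
have cxs k : continuous (xs k).
  by elim: k => [|k IH]; [exact: cst_continuous|exact: cT].
have cxB x y : continuous x -> continuous y -> continuous (x \- y).
  by move=> cx cy t; apply: cvgB; [exact: cx|exact: cy].
have step k t : `|xs k.+1 t - xs k t| <= B * q ^+ k * expR (m t).
  elim: k t => [|k IH] t.
    rewrite /= /T subr0 expr0 mulr1 (_ : conv _ _ _ = 0) ?addr0 ?fB//.
    rewrite /conv; under eq_Rintegral do rewrite mulr0.
    by rewrite Rintegral_cst ?mul0r.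
  rewrite [xs k.+2]/= -/(xs k.+1) [xs k.+1 in X in _ - X]/= -/(xs k) /T.
  rewrite opprD addrACA subrr add0r convB//; last exact: (cxs k.+1).
  apply: le_trans (conv_bound (D := B * q ^+ k) ig _ _ _) _ => //.
  - by apply: cxB; [exact: (cxs k.+1)|exact: cxs].
  - by move=> u /andP[u0 _]; have := IH u; rewrite mE.
  - by rewrite -/q exprSr !mulrA.
pose D := B / (1 - q).
have lim_ex t : exists l, forall k, `|l - xs k t| <= D * expR (m t) * q ^+ k.
  have [l lP] := @geometric_cauchy_limit (xs ^~ t) q (B * expR (m t)) q01
    (fun k => ltac:(by rewrite mulrAC; exact: step)).
  by exists l => k; rewrite [D * _]mulrAC; exact: lP.
have [x xP] := choice lim_ex.
(* The limit is chosen pointwise, but its rate is uniform on every half-line z <= t + 1, so the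
   usual three-term estimate through one iterate applies. *)
have cx : continuous x.
  move=> t; apply/cvgrPdist_le => e e0.
  have D0 : 0 <= D by rewrite divr_ge0// subr_ge0 ltW.
  pose E := D * expR (m (t + 1)).
  have [k kP] : exists k, E * q ^+ k <= e / 3.
    have : (fun k => E * q ^+ k) @ \oo --> E * 0.
      by apply: cvgM; [exact: cvg_cst|apply: cvg_expr; rewrite ger0_norm].
    rewrite mulr0 => /cvgrPdist_le /(_ (e / 3)).
    rewrite divr_gt0// => /(_ isT) [k _ /(_ k)/= kP]; exists k.
    have := kP (leqnn k); rewrite sub0r normrN; apply: le_trans; exact: ler_norm.
  have near_x z : z <= t + 1 -> `|x z - xs k z| <= e / 3.
    move=> zt; apply: le_trans (xP z k) (le_trans _ kP).
    rewrite ler_wpM2r ?exprn_ge0// ler_wpM2l// ler_expR /m ge_max !le_max zt.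
    by rewrite lexx orbT.
  have /cvgrPdist_le/(_ (e / 3)) := cxs k t.
  rewrite divr_gt0// => /(_ isT) ck.
  near=> z.
  have h1 : `|x t - xs k t| <= e / 3 by apply: near_x; rewrite lerDl.
  have h2 : `|x z - xs k z| <= e / 3.
    apply: near_x; apply: ltW; near: z; apply: lt_nbhsl; by rewrite ltrDl.
  have h3 : `|xs k t - xs k z| <= e / 3 by near: z.
  rewrite (_ : x t - x z = (x t - xs k t) + (xs k t - xs k z) - (x z - xs k z)); last ring.
  apply: le_trans (ler_normB _ _) _.
  apply: le_trans (lerD (ler_normD _ _) (lexx _)) _.
  by move: h1 h2 h3; lra.
exists x; split => //.
  exists D => t t0; have := xP t 0%N.
  by rewrite expr0 mulr1 /= subr0 mE.
(* The residual of x equals (x - xs (k+1)) minus the convolution of g with x - xs k, for every k.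
   Each term is at most D q^(k+1) exp t, hence the constant 2 D q exp t, and the residual vanishes
   as k grows. *)
move=> t t0; apply/eqP; rewrite -subr_eq0; apply/eqP.
apply: (@geometric_squeeze q (2 * D * q * expR t)) => // k.
rewrite (_ : _ - _ = (x t - xs k.+1 t) - conv g (x \- xs k) t); last first.
  by rewrite -convB//= /T mE//; ring.
apply: le_trans (ler_normB _ _) _.
have h1 := xP t k.+1.
have h2 : `|conv g (x \- xs k) t| <= D * q ^+ k * q * expR t.
  apply: conv_bound => //; first exact: cxB.
  by move=> u /andP[u0 _]; have := xP u k; rewrite mE// mulrAC.
move: h1 h2; rewrite mE// exprS => h1 h2.
apply: le_trans (lerD h1 h2) _.
by rewrite le_eqVlt; apply/orP; left; apply/eqP; ring.
Unshelve. all: by end_near. Qed.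

Lemma volterra_ge0 g x C :
  mu.-integrable hl (EFin \o g) -> (forall u, 0 <= u -> 0 <= g u) ->
  \int[mu]_(u in hl) (`|g u| * expR (- u)) < 1 ->
  continuous x -> (forall t, 0 <= t -> `|x t| <= C * expR t) ->
  (forall t, 0 <= t -> conv g x t <= x t) ->
  forall t, 0 <= t -> 0 <= x t.
Proof.
move=> ig g0; set q := Rintegral _ _ _ => q1 cx xC gx t t0.
have q0 : 0 <= q by apply: Rintegral_ge0 => u _; rewrite mulr_ge0 ?expR_ge0.
(* The negative part of x is at most its own convolution with g, and
   convolution with g contracts the weighted sup norm by q. *)
pose y u := Num.min (x u) 0.
have cy : continuous y.
  by move=> u; apply: (@continuous_min _ _ x (cst 0) u); [exact: cx|exact: cvg_cst].
have yC k u : 0 <= u -> `|y u| <= C * q ^+ k * expR u.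
  elim: k u => [|k IH] u u0.
    rewrite expr0 mulr1; apply: le_trans (xC _ u0).
    rewrite /y; have [xu|xu] := leP (x u) 0; first by [].
    by rewrite normr0.
  rewrite exprSr mulrA; have bd : `|conv g y u| <= C * q ^+ k * q * expR u.
    by apply: conv_bound => // v /andP[v0 _]; exact: IH.
  have yx : conv g y u <= conv g x u.
    apply: le_Rintegral => //.
    - by apply: conv_integrable => //; exact: integrable_halflineS.
    - by apply: conv_integrable => //; exact: integrable_halflineS.
    - move=> v /=; rewrite in_itv/= => /andP[v0 _].
      by rewrite ler_wpM2l ?g0// /y ge_min lexx.
  rewrite /y; have [xu0|xu0] := leP (x u) 0; last first.
    by rewrite normr0; exact: le_trans bd.
  rewrite ler0_norm// lerNl; move: bd; rewrite ler_norml => /andP[bd _].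
  by apply: le_trans bd _; exact: le_trans (gx _ u0).
have : y t = 0.
  apply: (@geometric_squeeze q (C * expR t)) => [|k]; first by rewrite q0.
  by rewrite mulrAC; exact: yC.
by rewrite /y; have [_ ->//|xt _] := leP (x t) 0; exact: ltW.
Qed.

End Volterra.

(** * Translation invariance and the integral of a convolution *)

Section Fubini.
Variable R : realType.
Local Notation mu := (@lebesgue_measure R).
Local Notation hl := (@halfline R).
Implicit Types (f g h x y : R -> R) (s t q B C : R).

Lemma measurable_subr t : measurable_fun setT (fun u : measurableTypeR R => u - t : measurableTypeR R).
Proof. exact: measurable_funB. Qed.

(** Lebesgue measure is determined by its values on half-open intervals, and a shift preserves their
    length. *)
Lemma lebesgue_measure_shift t (A : set (measurableTypeR R)) : measurable A ->
  mu A = pushforward mu (fun u : measurableTypeR R => u - t : measurableTypeR R) A.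
Proof.
pose phi := fun u : measurableTypeR R => u - t : measurableTypeR R.
pose F := isMeasurableFun.Build _ _ _ _ phi (measurable_subr t).
pose phi' : {mfun measurableTypeR R >-> measurableTypeR R} := HB.pack phi F.
move=> mA; apply: (@lebesgue_measure_unique R (pushforward mu phi')) => // X [[a b] _ <-].
change (mu `]a, b]%classic = mu (phi @^-1` `]a, b]%classic)).
rewrite (_ : phi @^-1` _ = `]a + t, b + t]%classic); last first.
  by apply/seteqP; split => u /=; rewrite !in_itv/= /phi ltrBrDr lerBlDr.
rewrite !lebesgue_measure_itv/= !lte_fin ltrD2r; case: ifP => // _.
by rewrite -!EFinB; congr (_%:E); ring.
Qed.

Lemma ge0_integral_shift t (f : R -> \bar R) :
  measurable_fun setT f -> (forall u, (0 <= f u)%E) ->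
  (\int[mu]_u f (u - t)%R = \int[mu]_u f u)%E.
Proof.
move=> mf f0.
have := @ge0_integral_pushforward _ _ _ _ _ _ (measurable_subr t) mu setT f.
move=> /(_ measurableT mf (fun u _ => f0 u)).
rewrite preimage_setT => <-.
apply: eq_measure_integral => [|mt A mA _]; first exact: measurable_subr.
by rewrite [RHS](lebesgue_measure_shift t mA).
Qed.

Lemma integrable_shift t (f : R -> \bar R) :
  mu.-integrable setT f -> mu.-integrable setT (fun u => f (u - t)).
Proof.
move=> /integrableP[mf fi]; apply/integrableP; split.
  apply: (measurableT_comp mf); exact: measurable_subr.
rewrite (@ge0_integral_shift t (fun u => `|f u|%E))//.
exact: measurableT_comp.
Qed.

Lemma integral_shift t (f : R -> \bar R) : mu.-integrable setT f ->
  (\int[mu]_u f (u - t)%R = \int[mu]_u f u)%E.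
Proof.
move=> fi; have mf := measurable_int mu fi.
have := @integral_pushforward _ _ _ _ _ _ (measurable_subr t) mu setT f mf.
rewrite preimage_setT => /(_ (integrable_shift t fi) measurableT) <-.
apply: eq_measure_integral => [|mt A mA _]; first exact: measurable_subr.
by rewrite [RHS](lebesgue_measure_shift t mA).
Qed.

(** Fubini for f u * g (v - u): by translation invariance the inner integral over v is f u times the
    integral of g. The same computation with absolute values gives integrability on the product. *)
Lemma integral_convolution f g B :
  mu.-integrable setT (EFin \o f) -> mu.-integrable setT (EFin \o g) ->
  (forall u, `|g u| <= B) ->
  \int[mu]_t (\int[mu]_u (f u * g (t - u))) =
  (\int[mu]_u f u) * (\int[mu]_u g u).
Proof.
move=> fi gi gB.
have mf : measurable_fun setT f by apply/measurable_EFinP; exact: measurable_int fi.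
have mg : measurable_fun setT g by apply/measurable_EFinP; exact: measurable_int gi.
pose F (z : R * R) := (f z.1 * g (z.2 - z.1))%:E.
have mF : measurable_fun setT F.
  apply/measurable_EFinP; apply: measurable_funM.
    exact: measurableT_comp.
  by apply: measurableT_comp => //; apply: measurable_funB.
have EG : (\int[mu]_v (g v)%:E = (\int[mu]_v g v)%:E)%E.
  by rewrite /Rintegral fineK//; exact: integrable_fin_num.
have gn := integrable_norm gi.
have EGn : (\int[mu]_v (`|g v|)%:E = (\int[mu]_v `|g v|)%:E)%E.
  by rewrite /Rintegral fineK//; exact: integrable_fin_num.
have iF : (mu \x mu)%E.-integrable setT F.
  apply/(integrable12ltyP mu mu mF).
  under eq_integral => u _.
    rewrite (_ : (\int[mu]_v _ = (\int[mu]_v `|g v| * `|f u|)%:E)%E); last first.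
      under eq_integral do rewrite /F/= normrM EFinM.
      rewrite ge0_integralZl//.
      - rewrite (@ge0_integral_shift u (fun v => `|g v|%:E))//.
        + by rewrite EGn mulrC -EFinM.
        + exact: measurable_int gn.
      - apply/measurable_EFinP; apply: measurableT_comp => //.
        by apply: measurableT_comp => //; exact: measurable_subr.
    over.
  apply: (@integrable_lty _ _ _ mu) => //.
  by apply: (@integrable_scale _ setT) => //; exact: integrable_norm.
have fub := Fubini iF.
have E1 : (\int[mu]_u \int[mu]_v F (u, v) = (\int[mu]_u f u * \int[mu]_v g v)%:E)%E.
  rewrite mulrC -RintegralZl// /Rintegral fineK; last first.
    by apply: integrable_fin_num => //; exact: (@integrable_scale _ setT).
  apply: eq_integral => u _; rewrite /F/=.
  under eq_integral do rewrite EFinM.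
  rewrite integralZl//; last exact: (integrable_shift u gi).
  by rewrite (integral_shift u gi) /= EG mulrC EFinM.
(* The bound on g makes the slice in u integrable for every v, so that passing through [fine] loses
   nothing; Fubini alone gives this for almost every v. *)
have E2 : (\int[mu]_v \int[mu]_u F (u, v) =
    \int[mu]_v (\int[mu]_u (f u * g (v - u)))%:E)%E.
  apply: eq_integral => v _; rewrite /Rintegral fineK//.
  apply: integrable_fin_num => //.
  apply: (@integrable_mul_bounded _ setT _ _ B) => //.
  by apply: measurableT_comp => //; exact: measurable_funB.
by rewrite [LHS]/Rintegral -E2 -fub E1.
Qed.

End Fubini.

(** * Laplace transforms of real functions and the convolution theorem *)

Section RealLaplace.
Variable R : realType.
Local Notation mu := (@lebesgue_measure R).
Local Notation hl := (@halfline R).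
Implicit Types (f g h x y : R -> R) (s t q B C : R).

Definition rlaplace f s : R := \int[mu]_(t in hl) (expR (- (s * t)) * f t).

Lemma continuous_expRN s : continuous (fun t => expR (- (s * t))).
Proof.
move=> t; apply: continuous_comp; last exact: continuous_expR.
by apply: cvgN; apply: cvgM; [exact: cvg_cst|exact: cvg_id].
Qed.

Lemma integrable_expRN s : 0 < s ->
  mu.-integrable hl (EFin \o (fun t => expR (- (s * t)))).
Proof.
move=> s0; have mhl := @measurable_halfline R.
have /(integrableS measurableT mhl (@subsetT _ _)) := @integrable_exponential_pdf R s s0.
move=> /(integrable_scale s^-1 mhl).
apply: eq_integrable => // t; rewrite inE /halfline/= in_itv/= andbT => t0.
by rewrite exponential_pdfE// mulrA mulVf ?gt_eqF// mul1r mulNr.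
Qed.

Lemma Rintegral_expRN s : 0 < s -> \int[mu]_(t in hl) expR (- (s * t)) = s^-1.
Proof.
move=> s0; have mhl := @measurable_halfline R.
apply: (@mulfI _ s); first by rewrite gt_eqF.
rewrite mulfV ?gt_eqF// -RintegralZl//; last exact: integrable_expRN.
have := integral_exponential_pdf s0; rewrite /exponential_pdf => E.
rewrite Rintegral_mkcond /Rintegral -[RHS]/(fine 1%E) -E; congr fine.
by apply: eq_integral => t _; rewrite !patchE; case: ifP => // _; rewrite mulNr.
Qed.

Lemma laplace_integrable f C s : 1 < s -> continuous f ->
  (forall t, 0 <= t -> `|f t| <= C * expR t) ->
  mu.-integrable hl (EFin \o (fun t => expR (- (s * t)) * f t)).
Proof.
move=> s1 cf fC; have mhl := @measurable_halfline R.
have s0 : 0 < s - 1 by rewrite subr_gt0.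
(* The factor exp(-st) is split as exp(-(s-1)t) exp(-t): the second part bounds f by C, the first is
   integrable. *)
have : mu.-integrable hl (EFin \o (fun t => expR (- ((s - 1) * t)) * (expR (- t) * f t))).
  apply: (@integrable_mul_bounded _ _ _ _ C) => //.
  - exact: integrable_expRN.
  - apply: measurable_funTS; apply: continuous_measurable_fun => t.
    apply: cvgM; last exact: cf.
    by apply: continuous_comp; [exact: continuousN|exact: continuous_expR].
  - move=> t; rewrite /halfline/= in_itv/= andbT => /fC ft.
    rewrite normrM ger0_norm ?expR_ge0// mulrC -ler_pdivlMr ?expR_gt0//.
    by rewrite expRN invrK.
apply: eq_integrable => // t _ /=; rewrite mulrA -expRD.
by congr ((expR _ * _)%:E); ring.
Qed.

(** Extension by zero turns the causal convolution into one on the whole line, the supports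
    producing the range 0 <= u <= t; the weight splits as exp(-st) = exp(-su) exp(-s(t-u)). *)
Lemma rlaplace_conv h x C s : 1 < s ->
  mu.-integrable hl (EFin \o h) -> continuous x ->
  (forall t, 0 <= t -> `|x t| <= C * expR t) ->
  rlaplace (conv h x) s = rlaplace h s * rlaplace x s.
Proof.
move=> s1 ih cx xC; have mhl := @measurable_halfline R.
have s0 : 0 < s by rewrite (lt_trans _ s1).
pose f := (fun t => expR (- (s * t)) * h t) \_ hl.
pose g := (fun t => expR (- (s * t)) * x t) \_ hl.
have fi : mu.-integrable setT (EFin \o f).
  rewrite /f -restrict_EFin; apply/integrable_restrict => //; rewrite setTI.
  have : mu.-integrable hl (EFin \o (fun t => h t * expR (- (s * t)))).
    apply: (@integrable_mul_bounded _ _ _ _ 1) => //.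
    - apply: measurable_funTS; apply: continuous_measurable_fun.
      exact: continuous_expRN.
    - move=> t; rewrite /halfline/= in_itv/= andbT => t0.
      by rewrite ger0_norm ?expR_ge0// expR_le1// oppr_le0 mulr_ge0// ltW.
  by apply: eq_integrable => // t _ /=; rewrite mulrC.
have gi : mu.-integrable setT (EFin \o g).
  rewrite /g -restrict_EFin; apply/integrable_restrict => //; rewrite setTI.
  exact: laplace_integrable xC.
have C0 : 0 <= C by have := xC 0 (lexx _); rewrite expR0 mulr1; exact: le_trans.
have gB u : `|g u| <= C.
  rewrite /g patchE; case: ifPn => [|_]; last by rewrite normr0.
  rewrite inE /halfline/= in_itv/= andbT => u0.
  rewrite normrM ger0_norm ?expR_ge0//.
  apply: le_trans (ler_wpM2l (expR_ge0 _) (xC _ u0)) _.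
  rewrite mulrCA -expRD ler_piMr// expR_le1// addrC subr_le0.
  by rewrite ler_peMl// ltW.
have := integral_convolution fi gi gB.
rewrite [\int[mu]_u f u](_ : _ = rlaplace h s); last by rewrite /rlaplace [RHS]Rintegral_mkcond.
rewrite [\int[mu]_u g u](_ : _ = rlaplace x s); last by rewrite /rlaplace [RHS]Rintegral_mkcond.
move=> <-; rewrite /rlaplace [LHS]Rintegral_mkcond; apply: eq_Rintegral => t _.
rewrite patchE; case: ifPn => [|]; rewrite ?notin_setE ?inE /halfline/= in_itv/= andbT => t0.
  rewrite /conv -RintegralZl//; last first.
    by apply: conv_integrable => //; exact: integrable_halflineS.
  rewrite [LHS]Rintegral_mkcond; apply: eq_Rintegral => u _.
  rewrite /f /g !patchE !mem_setE !in_itv/= !andbT subr_ge0.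
  case: (leP 0 u) => [u0|_]; last by rewrite mul0r.
  case: leP => [ut|_]; last by rewrite mulr0.
  by rewrite mulrACA -expRD /= mulrA mulrA; congr (expR _ * _ * _); ring.
rewrite [RHS](@eq_Rintegral _ _ _ mu _ (cst 0)) ?Rintegral_cst ?mul0r// => u _.
rewrite /f /g !patchE !mem_setE !in_itv/= !andbT subr_ge0.
case: (leP 0 u) => [u0|_]; last by rewrite mul0r.
by case: leP => [ut|_]; [case: t0; exact: le_trans ut|rewrite mulr0].
Qed.

End RealLaplace.

(** * Mass on the half-line and the initial value theorem *)

Section Halfline.
Variable R : realType.
Local Notation mu := (@lebesgue_measure R).
Local Notation hl := (@halfline R).
Implicit Types (f g : R -> R) (s t B : R).

(** Monotone convergence along the intervals [0, k]: a bound uniform in the endpoint becomes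
    integrability together with the same bound. *)
Lemma integrable_halfline f B : (forall t, 0 <= t -> 0 <= f t) ->
  (forall t, 0 <= t -> mu.-integrable `[0, t] (EFin \o f)) ->
  (forall t, 0 <= t -> \int[mu]_(u in `[0, t]) f u <= B) ->
  mu.-integrable hl (EFin \o f) /\ \int[mu]_(u in hl) f u <= B.
Proof.
move=> f0 fi fB.
pose I k : set R := `[0, 0 + k%:R]%classic.
have mI k : measurable (I k : set (measurableTypeR R)) by exact: measurable_itv.
have hlE : hl = \bigcup_k I k by exact: itv_bndy_bigcup_BRight.
have k0 k : 0 <= 0 + k%:R :> R by rewrite add0r.
have mf : measurable_fun (hl : set (measurableTypeR R)) (EFin \o f).
  rewrite hlE; apply/(measurable_fun_bigcup _ mI) => k.
  exact: measurable_int (fi _ (k0 k)).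
have f0' x : hl x -> (0 <= (f x)%:E)%E.
  by rewrite /halfline/= in_itv/= andbT lee_fin; exact: f0.
have ndI : nondecreasing_seq I.
  move=> j k jk; apply/subsetPset => t; rewrite /I/= !in_itv/= => /andP[-> tj]/=.
  by apply: le_trans tj _; rewrite lerD2l ler_nat.
have intB : (\int[mu]_(u in hl) (f u)%:E <= B%:E)%E.
  have f0I k x : I k x -> (0 <= (EFin \o f) x)%E.
    by rewrite /I/= in_itv/= lee_fin => /andP[x0 _]; exact: f0.
  have mfI k : measurable_fun (I k : set (measurableTypeR R)) (EFin \o f).
    exact: measurable_int (fi _ (k0 k)).
  have cv : (\int[mu]_(u in I k) (f u)%:E @[k --> \oo] --> \int[mu]_(u in hl) (f u)%:E)%E.
    by rewrite hlE; apply: ge0_nondecreasing_set_cvg_integral.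
  rewrite -(cvg_lim _ cv)//; apply: lime_le; first by apply/cvg_ex; eexists; exact: cv.
  apply: nearW => k; rewrite -[leLHS]fineK; last first.
    by apply: integrable_fin_num => //; exact: fi.
  by rewrite lee_fin; exact: fB.
have hi : mu.-integrable hl (EFin \o f).
  apply/integrableP; split => //.
  rewrite (@eq_integral _ _ _ mu hl (fun u => (f u)%:E)) ?(le_lt_trans intB) ?ltry// => u.
  by rewrite inE => /f0' ?; rewrite gee0_abs.
split=> //; rewrite -lee_fin /Rintegral fineK//.
apply: integrable_fin_num => //; exact: measurable_halfline.
Qed.

(** Strictness survives total mass 1. If the weighted integral were at least 1, then g(u)(1 -
    exp(-u)) >= 0 would have integral at most 0, so g would vanish almost everywhere off u = 0, and
    the weighted integral would be 0. *)
Lemma laplace1_lt1 g : (forall t, 0 <= t -> 0 <= g t) ->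
  mu.-integrable hl (EFin \o g) -> \int[mu]_(u in hl) g u <= 1 ->
  \int[mu]_(u in hl) (`|g u| * expR (- u)) < 1.
Proof.
move=> g0 gi gB; have mhl := @measurable_halfline R.
have g0' u : hl u -> 0 <= u by rewrite /halfline/= in_itv/= andbT.
have mexp : measurable_fun (hl : set (measurableTypeR R)) (fun u => expR (- u)).
  apply: measurable_funTS; apply: continuous_measurable_fun => u.
  by apply: continuous_comp; [exact: continuousN|exact: continuous_expR].
have ei : mu.-integrable hl (EFin \o (fun u => g u * expR (- u))).
  apply: (@integrable_mul_bounded _ _ _ _ 1) => // u /g0' u0.
  by rewrite ger0_norm ?expR_ge0// expR_le1// oppr_le0.
rewrite (@eq_Rintegral _ _ _ mu _ (fun u => g u * expR (- u))); last first.
  by move=> u; rewrite inE => /g0' u0; rewrite ger0_norm ?g0.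
rewrite ltNge; apply/negP => le1.
pose d u := g u - g u * expR (- u).
have di : mu.-integrable hl (EFin \o d).
  by have := integrableB mhl gi ei; apply: eq_integrable.
have d0 u : hl u -> 0 <= d u.
  move=> /g0' u0; rewrite /d subr_ge0 ler_piMr ?g0//.
  by rewrite expR_le1// oppr_le0.
have intd0 : (\int[mu]_(u in hl) `|(EFin \o d) u| = 0)%E.
  rewrite (@eq_integral _ _ _ mu hl (fun u => (d u)%:E)); last first.
    by move=> u; rewrite inE => /d0 ?; rewrite gee0_abs ?lee_fin.
  have fd : (\int[mu]_(u in hl) (d u)%:E)%E \is a fin_num by exact: integrable_fin_num.
  rewrite -(fineK fd) -/(Rintegral mu hl d); congr (_%:E); apply/eqP; rewrite eq_le.
  rewrite Rintegral_ge0// andbT /d RintegralB// subr_le0.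
  exact: le_trans le1.
have md := measurable_int mu di.
have /(ae_eq_integral_abs mu mhl md) dae := intd0.
have ne0 : \forall u \ae mu, u != 0 :> R.
  exists [set 0]; split; [exact: measurable_set1|exact: lebesgue_measure_set1|].
  by move=> u /negP; rewrite negbK => /eqP.
have int0 : \int[mu]_(u in hl) (g u * expR (- u)) = 0.
  rewrite /Rintegral (@ae_eq_integral _ _ _ mu hl (cst 0%E)) ?integral0//.
  - exact: measurable_int ei.
  - apply: filterS2 dae ne0 => u du une hu; have := du hu.
    move=> [] /eqP; rewrite /d -{1}[g u]mulr1 -mulrBr mulf_eq0 subr_eq0.
    move=> /orP[/eqP ->|]; first by rewrite mul0r.
    by rewrite -expR0 (inj_eq (@expR_inj R)) eq_sym oppr_eq0 (negbTE une).
by move: le1; rewrite int0 ler10.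
Qed.

(** The densities s exp(-st) have mass 1 and concentrate at 0. Continuity at 0 and boundedness
    combine into one affine bound on |f t - f 0|, whose average is computed explicitly. *)
Lemma initial_value f B e : continuous f -> (forall t, 0 <= t -> `|f t| <= B) -> 0 < e ->
  \forall s \near +oo, `|s * rlaplace f s - f 0| <= e.
Proof.
move=> cf fB e0; have mhl := @measurable_halfline R.
have B0 : 0 <= B by apply: le_trans (fB 0 _).
have /cvgrPdist_le/(_ (e / 2)) := cf 0; rewrite divr_gt0// => /(_ isT)[d /= d0 fd].
have d20 : 0 < d / 2 by rewrite divr_gt0.
(* The slope is such that L t exceeds 2 B, a bound for |f t - f 0|, as soon as t > d / 2. *)
pose L := 2 * B / (d / 2).
have L0 : 0 <= L by rewrite divr_ge0 ?mulr_ge0// ltW.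
have fL t : 0 <= t -> `|f t - f 0| <= e / 2 + L * t.
  move=> t0; have [td|dt] := leP t (d / 2).
    rewrite distrC; apply: le_trans (fd t _) _.
      by rewrite /= sub0r normrN ger0_norm//; apply: le_lt_trans td _; rewrite gtr_pMr// invf_lt1// ltr1n.
    by rewrite lerDl mulr_ge0.
  apply: le_trans (ler_normB _ _) _; apply: le_trans (lerD (fB _ t0) (fB _ (lexx _))) _.
  apply: ler_wpDl; first by rewrite divr_ge0// ltW.
  rewrite /L mulrAC ler_pdivlMr// -mulr2n -[_ *+ 2]mulr_natl; apply: ler_wpM2l.
    by rewrite mulr_ge0.
  exact: ltW.
near=> s.
have s1 : 1 < s by near: s; exact: nbhs_pinfty_gt.
have s0 : 0 < s by rewrite (lt_trans _ s1).
have s20 : 0 < s / 2 by rewrite divr_gt0.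
have ie := integrable_expRN s0; have ie2 := integrable_expRN s20.
have fBe t : 0 <= t -> `|f t| <= B * expR t.
  by move=> t0; apply: le_trans (fB _ t0) _; rewrite ler_peMr// -expR0 ler_expR.
have fi := laplace_integrable s1 cf fBe.
have f0E : f 0 = s * \int[mu]_(t in hl) (f 0 * expR (- (s * t))).
  by rewrite RintegralZl// Rintegral_expRN// mulrCA mulfV ?gt_eqF// mulr1.
rewrite [X in _ - X]f0E -mulrBr -RintegralB//; last exact: integrable_scale.
rewrite normrM gtr0_norm//.
have di : mu.-integrable hl (EFin \o (fun t => expR (- (s * t)) * f t - f 0 * expR (- (s * t)))).
  by have := integrableB mhl fi (integrable_scale (f 0) mhl ie); apply: eq_integrable.
have ri : mu.-integrable hl (EFin \o (fun t => e / 2 * expR (- (s * t)) + L * (2 / s) * expR (- (s / 2 * t)))).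
  have := integrableD mhl (integrable_scale (e / 2) mhl ie) (integrable_scale (L * (2 / s)) mhl ie2).
  by apply: eq_integrable.
apply: (@le_trans _ _ (s * \int[mu]_(t in hl) (e / 2 * expR (- (s * t)) + L * (2 / s) * expR (- (s / 2 * t))))).
  rewrite ler_pM2l//; apply: le_trans (le_normr_Rintegral _ di) _ => //.
  apply: le_Rintegral => //; first exact: (integrable_norm di).
  move=> t; rewrite /halfline/= in_itv/= andbT => t0.
  rewrite mulrC -mulrBl normrM (ger0_norm (expR_ge0 _)).
  apply: le_trans (ler_wpM2r (expR_ge0 _) (fL _ t0)) _.
  (* trades the factor t for half of the exponential decay *)
  have key : t <= 2 / s * expR (s / 2 * t).
    have tE : t = 2 / s * (s / 2 * t) by field; rewrite gt_eqF.
    rewrite {1}tE ler_wpM2l ?divr_ge0 ?(ltW s0)//.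
    by apply: le_trans (expR_ge1Dx _); rewrite lerDr.
  rewrite mulrDl lerD2l -(mulrA L t) -(mulrA L (2 / s)) ler_wpM2l//.
  apply: le_trans (ler_wpM2r (expR_ge0 _) key) _.
  rewrite -(mulrA (2 / s)) -expRD ler_wpM2l ?divr_ge0 ?(ltW s0)// ler_expR.
  by rewrite le_eqVlt; apply/orP; left; apply/eqP; field.
rewrite RintegralD//; try exact: integrable_scale.
rewrite !RintegralZl// !Rintegral_expRN//.
(* One factor 2 / s comes from trading t for decay, the other is the integral at rate s / 2; the
   leading s cancels one power. *)
rewrite (_ : s * _ = e / 2 + 4 * L / s); last by field; rewrite gt_eqF.
suff : 4 * L / s <= e / 2 by lra.
rewrite ler_pdivrMr// [X in _ <= X]mulrC -ler_pdivrMr ?divr_gt0//.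
Unshelve. all: by end_near. Qed.

End Halfline.

(** * Complex-valued functions *)

Section ComplexIntegral.
Local Open Scope complex_scope.
Variable R : realType.
Local Notation mu := (@lebesgue_measure R).
Local Notation hl := (@halfline R).
Local Notation C := R[i].
Local Notation Re := (@complex.Re R).
Local Notation Im := (@complex.Im R).
Implicit Types (z w h : R -> C) (c : C) (D : set R) (s t : R).

Lemma ReD (a b : C) : Re (a + b) = Re a + Re b. Proof. by case: a; case: b. Qed.
Lemma ImD (a b : C) : Im (a + b) = Im a + Im b. Proof. by case: a; case: b. Qed.
Lemma ReM (a b : C) : Re (a * b) = Re a * Re b - Im a * Im b.
Proof. by case: a; case: b. Qed.
Lemma ImM (a b : C) : Im (a * b) = Re a * Im b + Im a * Re b.
Proof. by case: a => ? ?; case: b. Qed.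

Definition cintegrable D z :=
  mu.-integrable D (EFin \o (fun t => Re (z t))) /\
  mu.-integrable D (EFin \o (fun t => Im (z t))).

(** Has the shape of the entries in [map_integralE], so that entries of an integrated map are
    convertible to a [cint]. *)
Definition cint D z : C :=
  (\int[mu]_(t in D) Re (z t)) +i* (\int[mu]_(t in D) Im (z t)).

Lemma eq_cint D z w : (forall t, D t -> z t = w t) -> cint D z = cint D w.
Proof.
by move=> zw; congr (_ +i* _); apply: eq_Rintegral => t; rewrite inE => Dt; rewrite zw.
Qed.

Lemma eq_cintegrable D z w : measurable (D : set (measurableTypeR R)) ->
  (forall t, D t -> z t = w t) -> cintegrable D z -> cintegrable D w.
Proof.
move=> mD zw [rz iz]; split.
  by apply: eq_integrable rz => // t; rewrite inE => Dt /=; rewrite zw.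
by apply: eq_integrable iz => // t; rewrite inE => Dt /=; rewrite zw.
Qed.

Section Linearity.
Variable D : set R.
Hypothesis mD : measurable (D : set (measurableTypeR R)).

Lemma cintegrable0 : cintegrable D (fun=> 0).
Proof. by split; exact: integrable0. Qed.

Lemma cintegrableD z w :
  cintegrable D z -> cintegrable D w -> cintegrable D (fun t => z t + w t).
Proof.
move=> [rz iz] [rw iw]; split.
  by have := integrableD mD rz rw; apply: eq_integrable => // t _ /=; rewrite ReD EFinD.
by have := integrableD mD iz iw; apply: eq_integrable => // t _ /=; rewrite ImD EFinD.
Qed.

Lemma cintegrableZ c z : cintegrable D z -> cintegrable D (fun t => c * z t).
Proof.
move=> [rz iz]; split.
  have := integrableB mD (integrable_scale (Re c) mD rz) (integrable_scale (Im c) mD iz).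
  by apply: eq_integrable => // t _ /=; rewrite ReM EFinB.
have := integrableD mD (integrable_scale (Re c) mD iz) (integrable_scale (Im c) mD rz).
by apply: eq_integrable => // t _ /=; rewrite ImM EFinD.
Qed.

Lemma cintegrable_sum (I : Type) (r : seq I) (z : I -> R -> C) :
  (forall i, cintegrable D (z i)) -> cintegrable D (fun t => \sum_(i <- r) z i t).
Proof.
move=> iz; elim: r => [|i r IH].
  by apply: eq_cintegrable cintegrable0 => // t _; rewrite big_nil.
apply: eq_cintegrable (cintegrableD (iz i) IH) => // t _; by rewrite big_cons.
Qed.

Lemma cint0 : cint D (fun=> 0) = 0.
Proof. by rewrite /cint !Rintegral_cst// mul0r. Qed.

Lemma cintD z w : cintegrable D z -> cintegrable D w ->
  cint D (fun t => z t + w t) = cint D z + cint D w.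
Proof.
move=> [rz iz] [rw iw]; rewrite /cint.
under eq_Rintegral do rewrite ReD.
under [X in _ +i* X]eq_Rintegral do rewrite ImD.
by rewrite !RintegralD.
Qed.

Lemma cintZ c z : cintegrable D z -> cint D (fun t => c * z t) = c * cint D z.
Proof.
move=> [rz iz]; rewrite /cint.
under eq_Rintegral do rewrite ReM.
under [X in _ +i* X]eq_Rintegral do rewrite ImM.
rewrite RintegralB ?RintegralD ?RintegralZl//; try exact: integrable_scale.
by case: c.
Qed.

Lemma cint_sum (I : Type) (r : seq I) (z : I -> R -> C) :
  (forall i, cintegrable D (z i)) ->
  cint D (fun t => \sum_(i <- r) z i t) = \sum_(i <- r) cint D (z i).
Proof.
move=> iz; elim: r => [|i r IH].
  by rewrite [RHS]big_nil -[RHS]cint0; apply: eq_cint => t _; rewrite big_nil.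
rewrite big_cons -IH -cintD//; last exact: cintegrable_sum.
by apply: eq_cint => t _; rewrite big_cons.
Qed.

Lemma cint_ge0 z : (forall t, D t -> 0 <= z t) -> 0 <= cint D z.
Proof.
move=> z0; rewrite lecE/=; apply/andP; split.
  rewrite (@eq_Rintegral _ _ _ mu _ (cst 0)) ?Rintegral_cst ?mul0r// => t.
  by rewrite inE => /z0 /ger0_Im.
by apply: Rintegral_ge0 => t /z0; rewrite lecE => /andP[].
Qed.

End Linearity.

(** The class in which the renewal equation is solved: exp t is the weight of the Picard iteration,
    the class is stable under convolution with integrable kernels (after freezing at 0), and its
    members have Laplace transforms for s > 1. *)
Definition exp_growth z :=
  [/\ continuous (fun t => Re (z t)), continuous (fun t => Im (z t)) &
    exists B, forall t, 0 <= t ->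
      `|Re (z t)| <= B * expR t /\ `|Im (z t)| <= B * expR t].

Lemma exp_growthD z w : exp_growth z -> exp_growth w -> exp_growth (fun t => z t + w t).
Proof.
move=> [crz ciz [B zB]] [crw ciw [B' wB]]; split.
- rewrite (_ : (fun t => _) = (fun t => Re (z t) + Re (w t))); last first.
    by apply/funext => t; rewrite ReD.
  by move=> t; apply: cvgD; [exact: crz|exact: crw].
- rewrite (_ : (fun t => _) = (fun t => Im (z t) + Im (w t))); last first.
    by apply/funext => t; rewrite ImD.
  by move=> t; apply: cvgD; [exact: ciz|exact: ciw].
- exists (B + B') => t t0; have [rz iz] := zB t t0; have [rw iw] := wB t t0.
  rewrite ReD ImD mulrDl; split; apply: le_trans (ler_normD _ _) _; exact: lerD.
Qed.

Lemma exp_growthZ c z : exp_growth z -> exp_growth (fun t => c * z t).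
Proof.
move=> [crz ciz [B zB]]; split.
- rewrite (_ : (fun t => _) = (fun t => Re c * Re (z t) - Im c * Im (z t))); last first.
    by apply/funext => t; rewrite ReM.
  by move=> t; apply: cvgB; apply: cvgM; [exact: cvg_cst|exact: crz|exact: cvg_cst|exact: ciz].
- rewrite (_ : (fun t => _) = (fun t => Re c * Im (z t) + Im c * Re (z t))); last first.
    by apply/funext => t; rewrite ImM.
  by move=> t; apply: cvgD; apply: cvgM; [exact: cvg_cst|exact: ciz|exact: cvg_cst|exact: crz].
- exists ((`|Re c| + `|Im c|) * B) => t t0; have [rz iz] := zB t t0.
  rewrite ReM ImM -mulrA mulrDl; split.
    apply: le_trans (ler_normB _ _) _; rewrite !normrM.
    by rewrite lerD// ler_wpM2l.
  apply: le_trans (ler_normD _ _) _; rewrite !normrM.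
  by rewrite lerD// ler_wpM2l.
Qed.

Lemma exp_growth_cst c : exp_growth (fun=> c).
Proof.
split; [exact: cst_continuous|exact: cst_continuous|].
exists (`|Re c| + `|Im c|) => t t0.
have e1 : 1 <= expR t by rewrite -expR0 ler_expR.
by split; rewrite -[leLHS]mulr1 ler_pM// ?lerDl ?lerDr.
Qed.

Lemma exp_growth_sum (I : Type) (r : seq I) (z : I -> R -> C) :
  (forall i, exp_growth (z i)) -> exp_growth (fun t => \sum_(i <- r) z i t).
Proof.
move=> ez; elim: r => [|i r IH].
  rewrite (_ : (fun t => _) = (fun=> 0)); first exact: exp_growth_cst.
  by apply/funext => t; rewrite big_nil.
rewrite (_ : (fun t => _) = (fun t => z i t + \sum_(j <- r) z j t)); first exact: exp_growthD.
by apply/funext => t; rewrite big_cons.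
Qed.

Definition cconv h z t : C := cint `[0, t] (fun u => h u * z (t - u)).

Lemma cintegrable_halflineS t z : cintegrable hl z -> cintegrable `[0, t] z.
Proof. by move=> [rz iz]; split; exact: integrable_halflineS. Qed.

Section Convolution.
Variables (h z : R -> C).
Hypotheses (ih : cintegrable hl h) (ez : exp_growth z).

Lemma cconv_integrable t : cintegrable `[0, t] (fun u => h u * z (t - u)).
Proof.
have mD : measurable (`[0, t]%classic : set (measurableTypeR R)) by exact: measurable_itv.
case: (cintegrable_halflineS t ih) => rh ih'; case: ez => crz ciz _.
split.
  have := integrableB mD (conv_integrable crz rh) (conv_integrable ciz ih').
  by apply: eq_integrable => // u _ /=; rewrite ReM EFinB.
have := integrableD mD (conv_integrable ciz rh) (conv_integrable crz ih').
by apply: eq_integrable => // u _ /=; rewrite ImM EFinD.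
Qed.

Let hr t := Re (h t). Let hi t := Im (h t).
Let zr t := Re (z t). Let zi t := Im (z t).

Lemma cconvE t : cconv h z t =
  (conv hr zr t - conv hi zi t) +i* (conv hr zi t + conv hi zr t).
Proof.
case: (cintegrable_halflineS t ih) => rh ih'; case: ez => crz ciz _.
rewrite /cconv /cint.
under eq_Rintegral do rewrite ReM.
under [X in _ +i* X]eq_Rintegral do rewrite ImM.
have c1 := conv_integrable crz rh; have c2 := conv_integrable ciz ih'.
have c3 := conv_integrable ciz rh; have c4 := conv_integrable crz ih'.
by rewrite (RintegralB _ c1 c2)// (RintegralD _ c3 c4).
Qed.

Lemma exp_growth_cconv : exp_growth (fun t => cconv h z (Num.max t 0)).
Proof.
case: ih => rh ih'; case: ez => crz ciz [B zB].
have c1 : continuous (fun t => conv hr zr (Num.max t 0)) by exact: conv_continuous.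
have c2 : continuous (fun t => conv hi zi (Num.max t 0)) by exact: conv_continuous.
have c3 : continuous (fun t => conv hr zi (Num.max t 0)) by exact: conv_continuous.
have c4 : continuous (fun t => conv hi zr (Num.max t 0)) by exact: conv_continuous.
split.
- rewrite (_ : (fun t => _) = (fun t => conv hr zr (Num.max t 0) - conv hi zi (Num.max t 0))).
    by move=> t; apply: cvgB; [exact: c1|exact: c2].
  by apply/funext => t; rewrite cconvE.
- rewrite (_ : (fun t => _) = (fun t => conv hr zi (Num.max t 0) + conv hi zr (Num.max t 0))).
    by move=> t; apply: cvgD; [exact: c3|exact: c4].
  by apply/funext => t; rewrite cconvE.
- exists (B * (\int[mu]_(u in hl) (`|hr u| * expR (- u))) +
          B * (\int[mu]_(u in hl) (`|hi u| * expR (- u)))) => t t0.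
  rewrite max_l// cconvE/= mulrDl.
  split.
    apply: le_trans (ler_normB _ _) _; apply: lerD; apply: conv_bound => // u /andP[u0 _].
      exact: (zB u u0).1.
    exact: (zB u u0).2.
  apply: le_trans (ler_normD _ _) _; apply: lerD; apply: conv_bound => // u /andP[u0 _].
    exact: (zB u u0).2.
  exact: (zB u u0).1.
Qed.

Definition claplace (w : R -> C) s : C := cint hl (fun t => (expR (- (s * t)))%:C * w t).

Lemma claplaceE (w : R -> C) s : claplace w s =
  (rlaplace (fun t => Re (w t)) s) +i* (rlaplace (fun t => Im (w t)) s).
Proof. by congr (_ +i* _); apply: eq_Rintegral => t _; rewrite ?ReM ?ImM /=; ring. Qed.

Lemma claplace_conv s : 1 < s -> claplace (cconv h z) s = claplace h s * claplace z s.
Proof.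
move=> s1; case: ih => rh ih'; case: ez => crz ciz [B zB].
have mhl := @measurable_halfline R.
have zBr t : 0 <= t -> `|zr t| <= B * expR t by move=> /zB[].
have zBi t : 0 <= t -> `|zi t| <= B * expR t by move=> /zB[].
rewrite !claplaceE.
have cI (k : R -> R) (y : R -> R) : mu.-integrable hl (EFin \o k) ->
    continuous y -> (forall t, 0 <= t -> `|y t| <= B * expR t) ->
    mu.-integrable hl (EFin \o (fun t => expR (- (s * t)) * conv k y t)).
  move=> ik cy yB.
  have := @laplace_integrable R (fun t => conv k y (Num.max t 0))
     (B * (\int[mu]_(u in hl) (`|k u| * expR (- u)))) s s1 (conv_continuous ik cy).
  move=> /(_ _)/wrap[t t0|].
    by rewrite max_l//; apply: conv_bound => // u /andP[u0 _]; exact: yB.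
  by apply: eq_integrable => // t; rewrite inE /halfline/= in_itv/= andbT => t0; rewrite max_l.
rewrite -[RHS]/((_ - _) +i* (_ + _)); congr (_ +i* _).
  rewrite -(rlaplace_conv s1 rh crz zBr) -(rlaplace_conv s1 ih' ciz zBi).
  rewrite /rlaplace -RintegralB//; try exact: cI.
  by apply: eq_Rintegral => t _; rewrite cconvE/= mulrBr.
rewrite -(rlaplace_conv s1 rh ciz zBi) -(rlaplace_conv s1 ih' crz zBr).
rewrite /rlaplace -RintegralD//; try exact: cI.
by apply: eq_Rintegral => t _; rewrite cconvE/= mulrDr.
Qed.

End Convolution.

Lemma claplace_integrable z s : 1 < s -> exp_growth z ->
  cintegrable hl (fun t => (expR (- (s * t)))%:C * z t).
Proof.
move=> s1 [crz ciz [B zB]]; have mhl := @measurable_halfline R.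
have zBr t : 0 <= t -> `|Re (z t)| <= B * expR t by move=> /zB[].
have zBi t : 0 <= t -> `|Im (z t)| <= B * expR t by move=> /zB[].
split.
  have := laplace_integrable s1 crz zBr.
  by apply: eq_integrable => // t _ /=; rewrite ReM /= mul0r subr0.
have := laplace_integrable s1 ciz zBi.
by apply: eq_integrable => // t _ /=; rewrite ImM /= mul0r addr0.
Qed.

End ComplexIntegral.

(** * Positive matrices and completely positive maps *)

Section PositiveMatrices.
Local Open Scope complex_scope.
Variable R : realType.
Local Notation C := R[i].
Local Notation adj v := (map_mx (@conjc R) v^T).

Definition sform m (u : 'cV[C]_m) (A : 'M[C]_m) (v : 'cV[C]_m) : C :=
  (adj u *m A *m v) 0 0.

Lemma sformE m (u v : 'cV[C]_m) (A : 'M[C]_m) :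
  sform u A v = \sum_i \sum_j (u i 0)^*%C * A i j * v j 0.
Proof.
rewrite /sform mxE exchange_big; apply: eq_bigr => j _.
by rewrite mxE mulr_suml; apply: eq_bigr => i _; rewrite !mxE.
Qed.

Lemma sform_delta m (A : 'M[C]_m) i j :
  sform (delta_mx i 0) A (delta_mx j 0) = A i j.
Proof.
rewrite /sform trmx_delta map_delta_mx -rowE -colE; by rewrite !mxE.
Qed.

Lemma sformDl m (u u' v : 'cV[C]_m) A : sform (u + u') A v = sform u A v + sform u' A v.
Proof. by rewrite /sform linearD map_mxD !mulmxDl mxE. Qed.

Lemma sformDr m (u v v' : 'cV[C]_m) A : sform u A (v + v') = sform u A v + sform u A v'.
Proof. by rewrite /sform mulmxDr mxE. Qed.

Lemma sformZl m c (u v : 'cV[C]_m) A : sform (c *: u) A v = c^*%C * sform u A v.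
Proof. by rewrite /sform linearZ map_mxZ -!scalemxAl mxE. Qed.

Lemma sformZr m c (u v : 'cV[C]_m) A : sform u A (c *: v) = c * sform u A v.
Proof. by rewrite /sform -scalemxAr mxE. Qed.

Lemma sform_rank1 m (u v p : 'cV[C]_m) :
  sform u (p *m adj p) v = (adj u *m p) 0 0 * (adj p *m v) 0 0.
Proof.
rewrite /sform mulmxA -mulmxA mxE big_ord1.
by [].
Qed.

Lemma adj_mulC m (u p : 'cV[C]_m) : (adj u *m p) 0 0 = ((adj p *m u) 0 0)^*%C.
Proof.
rewrite !mxE rmorph_sum; apply: eq_bigr => i _.
by rewrite !mxE rmorphM/= conjcK mulrC.
Qed.

Lemma psd_rank1 m (p : 'cV[C]_m) : psd (p *m adj p).
Proof.
move=> v; rewrite -/(sform v _ v) sform_rank1 adj_mulC mulrC.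
exact: mulcJ_ge0.
Qed.

(** The form is real on every vector. Testing it on e_i + c e_j with c = 1 relates the imaginary
    parts of the two entries, and c = i their real parts. *)
Lemma psd_hermitian m (A : 'M[C]_m) i j : psd A -> A j i = (A i j)^*%C.
Proof.
move=> pA.
pose e k : 'cV[C]_m := delta_mx k 0.
have expand c : sform (e i + c *: e j) A (e i + c *: e j) =
   A i i + c * A i j + (c^*%C * A j i + c^*%C * c * A j j).
  rewrite sformDl !sformDr !(sformZl, sformZr) !sform_delta.
  by rewrite -mulrA.
have reA k : complex.Im (A k k) = 0.
  by apply: ger0_Im; rewrite -sform_delta; exact: pA.
have h c : complex.Im (A i i + c * A i j + (c^*%C * A j i + c^*%C * c * A j j)) = 0.
  by apply: ger0_Im; rewrite -expand; exact: pA.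
have := h 1; have := h 'i; have := reA i; have := reA j.
case: (A i i) => a b; case: (A j j) => a' b'; case: (A i j) => x y; case: (A j i) => x' y'.
simpc => /= -> -> e1 e2; congr (_ +i* _); lra.
Qed.

Lemma psd_spectral m (A : 'M[C]_m) : psd A ->
  exists (d : 'I_m -> C) (p : 'I_m -> 'cV[C]_m),
    (forall l, 0 <= d l) /\ A = \sum_l d l *: (p l *m adj (p l)).
Proof.
move=> pA.
have hA : A \is hermsymmx.
  apply/is_hermitianmxP; rewrite expr0 scale1r; apply/matrixP => i j.
  by rewrite !mxE; exact: psd_hermitian.
have /orthomx_spectralP EA := hermitian_normalmx hA.
have uP := spectral_unitarymx A.
move: EA uP; set P := spectralmx A; set D := spectral_diag A => EA uP.
rewrite invmx_unitary// in EA.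
pose p l : 'cV[C]_m := adj (row l P).
have adjp l : adj (p l) = row l P.
  by apply/matrixP => i j; rewrite !mxE conjcK.
have EA' : A = \sum_l D 0 l *: (p l *m adj (p l)).
  rewrite {1}EA; apply/matrixP => i j; rewrite mxE summxE; apply: eq_bigr => l _.
  rewrite adjp mul_mx_diag [in RHS]mxE [X in _ = _ * X]mxE big_ord1 !mxE.
  by rewrite [_ * D 0 l]mulrC mulrA.
exists (D 0), p; split => // l.
have orth a b : (adj (p a) *m p b) 0 0 = (a == b)%:R.
  have /unitarymxP/matrixP/(_ a b) := uP.
  by rewrite adjp !mxE => <-; apply: eq_bigr => k _; rewrite !mxE.
(* By orthonormality the form at the eigenvector [p l] isolates the eigenvalue [D 0 l], which is
   therefore nonnegative. *)
have := pA (p l); rewrite -/(sform _ _ _) {1}EA' /sform mulmx_sumr mulmx_suml summxE.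
rewrite (bigD1 l)//= big1 ?addr0 => [|k kl].
  rewrite -scalemxAr -scalemxAl mxE -/(sform _ _ _) sform_rank1 !orth eqxx.
  by rewrite !mulr1.
rewrite -scalemxAr -scalemxAl mxE -/(sform _ _ _) sform_rank1 !orth.
by rewrite eq_sym (negbTE kl) mulr0 mulr0.
Qed.

Lemma mxtrace_rank1 m (u v : 'cV[C]_m) (a : 'M[C]_m) :
  \tr (u *m adj v *m a) = sform v a u.
Proof. by rewrite -mulmxA mxtrace_mulC /mxtrace big_ord1. Qed.

Lemma mxtrace_psd_ge0 m (P a : 'M[C]_m) : psd P -> psd a -> 0 <= \tr (P *m a).
Proof.
move=> /psd_spectral[d [p [d0 ->]]] pa.
rewrite mulmx_suml raddf_sum sumr_ge0//= => l _.
by rewrite -scalemxAl mxtraceZ mxtrace_rank1 mulr_ge0//; exact: pa.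
Qed.

Lemma psd_mxtrace_ge0 m (A : 'M[C]_m) : psd A -> 0 <= \tr A.
Proof.
move=> pA; rewrite /mxtrace sumr_ge0// => i _; rewrite -sform_delta; exact: pA.
Qed.

(** For a rank-one term the claim reads |p_i| |p_j| <= sum of |p_k|^2, where the larger of the two
    factors suffices. This turns a bound on traces into a bound on all entries. *)
Lemma psd_entry_le m (A : 'M[C]_m) i j : psd A -> `|A i j| <= \tr A.
Proof.
move=> /psd_spectral[d [p [d0 ->]]].
rewrite raddf_sum/= summxE (le_trans (ler_norm_sum _ _ _))// ler_sum// => l _.
rewrite mxE mxtraceZ normrM ger0_norm// ler_wpM2l// mxE big_ord1 !mxE normrM normcJ.
have -> : \tr (p l *m adj (p l)) = \sum_k `|p l k 0| ^+ 2.
  by apply: eq_bigr => k _; rewrite mxE big_ord1 !mxE sqr_normc.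
have le1 k : `|p l k 0| ^+ 2 <= \sum_k `|p l k 0| ^+ 2.
  by rewrite (bigD1 k)//= lerDl sumr_ge0// => ? _; rewrite exprn_ge0.
have [h|h] := real_leP (normr_real (p l i 0)) (normr_real (p l j 0)).
  by apply: le_trans (le1 j); rewrite expr2 ler_wpM2r.
by apply: le_trans (le1 i); rewrite expr2 ler_wpM2l// ltW.
Qed.

(** Psd matrices span, so a property stable under linear combinations may be checked where
    positivity is available. It carries boundedness of N_t(a) and integrability of tr(F_t a) to
    arbitrary a. *)
Lemma psd_ind m (S : 'M[C]_m -> Prop) :
  (forall a, psd a -> S a) ->
  (forall c a b, S a -> S b -> S (c *: a + b)) -> forall a, S a.
Proof.
move=> Spsd Slin a.
have S0 : S 0.
  by apply: Spsd => v; rewrite mulmx0 mul0mx mxE.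
have SD u v : S u -> S v -> S (u + v) by move=> su sv; rewrite -[u]scale1r; exact: Slin.
have SZ c u : S u -> S (c *: u) by move=> su; rewrite -[_ *: _]addr0; exact: Slin.
rewrite [a]matrix_sum_delta.
apply: (big_ind S) => // i _; apply: (big_ind S) => // j _; apply: (SZ).
pose e k : 'cV[C]_m := delta_mx k 0.
pose r (u : 'cV[C]_m) := u *m adj u.
have Sr u : S (r u) by apply: Spsd; exact: psd_rank1.
(* polarization *)
have -> : delta_mx i j = 2^-1 *: (r (e i + e j) + 'i%C *: r (e i + 'i%C *: e j)
     - (1 + 'i%C) *: (r (e i) + r (e j))) :> 'M[C]_m.
  have rE u k l : r u k l = u k 0 * (u l 0)^*%C by rewrite mxE big_ord1 !mxE.
  have cn (b : bool) : (b%:R : C)^*%C = b%:R by rewrite (rmorph_nat (@conjc R)).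
  have cD (x y : C) : (x + y)^*%C = x^*%C + y^*%C by exact: (rmorphD (@conjc R)).
  have cM (x y : C) : (x * y)^*%C = x^*%C * y^*%C by exact: (rmorphM (@conjc R)).
  have i2 : 'i%C * 'i%C = -1 :> C by rewrite -expr2 sqr_i.
  have ic : 'i%C^*%C = - 'i%C :> C by simpc.
  apply/matrixP => k l; do !rewrite ?rE mxE; rewrite !andbT !(cD, cM, cn) ic.
  apply: (@mulfI _ 2); first by rewrite pnatr_eq0.
  rewrite [RHS]mulrA mulfV ?pnatr_eq0// mul1r -mulnb natrM.
  move: ((k == i)%:R : C) ((k == j)%:R : C) ((l == i)%:R : C) ((l == j)%:R : C) => x y z t.
  move: ('i%C : C) i2 {ic} => I i2.
  (* With the imaginary unit abstracted to I, the two sides differ by a multiple of I * I + 1; once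
     this multiple is explicit, [ring] applies. *)
  rewrite [RHS](_ : _ = 2 * (x * t) + (I * I + 1) * (y * z - x * t - I * y * t)).
    by rewrite i2 addNr mul0r addr0.
  by ring.
apply: (SZ); apply: (SD); first by apply: (SD) => //; exact: SZ.
by rewrite -scaleNr; apply: SZ; exact: SD.
Qed.

End PositiveMatrices.

(** * Complete positivity in block form and measure-and-prepare maps *)

Section CompletePositivity.
Local Open Scope complex_scope.
Variables (R : realType) (n : nat).
Local Notation C := R[i].
Local Notation adj v := (map_mx (@conjc R) v^T).

Lemma sform_mxblock k (B : 'I_k -> 'I_k -> 'M[C]_n) (v : 'I_k -> 'cV[C]_n) :
  sform (\mxcol_i v i) (\mxblock_(i, j) B i j) (\mxcol_i v i) =
  \sum_i \sum_j sform (v i) (B i j) (v j).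
Proof.
rewrite /sform tr_mxcol.
have -> : map_mx (@conjc R) (\mxrow_i (v i)^T) = \mxrow_i adj (v i).
  by apply/matrixP => i j; rewrite !mxE.
rewrite mul_mxrow_mxblock mul_mxrow_mxcol exchange_big summxE; apply: eq_bigr => j _.
by rewrite mulmx_suml summxE.
Qed.

Lemma psd_mxblockP k (A : 'M[C]_(\sum_(i < k) n)) :
  psd A <-> forall v : 'I_k -> 'cV[C]_n,
    0 <= \sum_i \sum_j sform (v i) (submxblock A i j) (v j).
Proof.
split=> [pA v|pA v].
  rewrite -(sform_mxblock (fun i j => submxblock A i j)) submxblockK; exact: pA.
rewrite -/(sform v A v) -(submxcolK v) -(submxblockK A) sform_mxblock.
exact: pA.
Qed.

Lemma completely_positiveP (K : superop R n) :
  completely_positive K <-> forall k (A : 'M[C]_(\sum_(i < k) n)), psd A ->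
    forall v : 'I_k -> 'cV[C]_n,
      0 <= \sum_i \sum_j sform (v i) (K (submxblock A i j)) (v j).
Proof.
split=> cp k A pA.
  move=> v; have /psd_mxblockP/(_ v) := cp k A pA.
  by under eq_bigr do under eq_bigr do rewrite mxblockK.
apply/psd_mxblockP => v.
by under eq_bigr do under eq_bigr do rewrite mxblockK; exact: cp.
Qed.

Lemma completely_positive_psd (K : superop R n) a :
  completely_positive K -> psd a -> psd (K a).
Proof.
move=> /completely_positiveP cp pa u; rewrite -/(sform u (K a) u).
have pA : psd (\mxblock_(i < 1, j < 1) a).
  by apply/psd_mxblockP => v; rewrite !big_ord1 mxblockK; exact: pa.
by have := cp 1%N _ pA (fun=> u); rewrite !big_ord1 mxblockK.
Qed.

Let measure_prepare_fun (P W a : 'M[C]_n) := \tr (P *m a) *: W.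

Let measure_prepare_fun_is_linear P W : linear (measure_prepare_fun P W).
Proof. by move=> c a b; rewrite /measure_prepare_fun linearP/= mxtraceD mxtraceZ scalerDl scalerA. Qed.

(** For psd P and W this is, up to normalization, an entanglement-breaking map: the effect P is
    measured and the state W prepared. *)
Definition measure_prepare (P W : 'M[C]_n) : superop R n := linfun (fun a => \tr (P *m a) *: W).

Lemma measure_prepareE P W a : measure_prepare P W a = \tr (P *m a) *: W.
Proof.
pose L := GRing.isLinear.Build _ _ _ _ _ (measure_prepare_fun_is_linear P W).
pose g : {linear 'M[R[i]]_n -> 'M[R[i]]_n} := HB.pack (measure_prepare_fun P W) L.
exact: (lfunE g).
Qed.

Lemma measure_prepare_completely_positive P W : psd P -> psd W -> completely_positive (measure_prepare P W).
Proof.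
move=> /psd_spectral[d [p [d0 EP]]] /psd_spectral[e [w [e0 EW]]].
apply/completely_positiveP => k A /psd_mxblockP pA v.
(* Up to weights the Kraus operators are w_m times the adjoint of p_l; [c l m i] is the image of
   [v i] under the adjoint operator. The block form of the image is thus a nonnegative combination
   of block forms of A. *)
pose c l m i : 'cV[C]_n := ((adj (w m) *m v i) 0 0) *: p l.
have E i j : sform (v i) (measure_prepare P W (submxblock A i j)) (v j) =
    \sum_l \sum_m d l * e m * sform (c l m i) (submxblock A i j) (c l m j).
  rewrite measure_prepareE /sform -scalemxAr -scalemxAl mxE.
  rewrite {1}EP mulmx_suml raddf_sum/= mulr_suml; apply: eq_bigr => l _.
  rewrite {1}EW mulmx_sumr mulmx_suml summxE mulr_sumr; apply: eq_bigr => m _.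
  rewrite -/(sform (c l m i) _ _) sformZl sformZr.
  rewrite -scalemxAl mxtraceZ mxtrace_rank1 -scalemxAr -scalemxAl mxE.
  rewrite -/(sform (v i) _ _) sform_rank1 adj_mulC.
  by ring.
under eq_bigr do under eq_bigr do rewrite E.
under eq_bigr do rewrite exchange_big/=.
rewrite exchange_big sumr_ge0//= => l _.
under eq_bigr do rewrite exchange_big/=.
rewrite exchange_big sumr_ge0//= => m _.
under eq_bigr do rewrite -mulr_sumr.
by rewrite -mulr_sumr !mulr_ge0.
Qed.

Lemma mxtrace_dual1 (K : superop R n) a : \tr (dual K 1%:M *m a) = \tr (K a).
Proof. by rewrite dualP mul1mx. Qed.

Lemma mxtrace_mul_inj (X Y : 'M[C]_n) : (forall b, \tr (X *m b) = \tr (Y *m b)) -> X = Y.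
Proof.
move=> XY; apply/matrixP => i j.
have E (Z : 'M[C]_n) : \tr (Z *m ((delta_mx j 0 : 'cV[C]_n) *m adj (delta_mx i 0 : 'cV[C]_n))) = Z i j.
  by rewrite mxtrace_mulC mxtrace_rank1 sform_delta.
by rewrite -(E X) -(E Y) XY.
Qed.

End CompletePositivity.

(** * The renewal equation and its solution *)

Section ComplexVolterra.
Local Open Scope complex_scope.
Variable R : realType.
Local Notation mu := (@lebesgue_measure R).
Local Notation hl := (@halfline R).
Local Notation C := R[i].
Local Notation Re := (@complex.Re R).
Local Notation Im := (@complex.Im R).
Implicit Types (z w h : R -> C) (g : R -> R) (c : C) (s t : R).

Lemma cconv_realE g z t : mu.-integrable hl (EFin \o g) -> exp_growth z ->
  cconv (fun u => (g u)%:C) z t =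
  (conv g (fun u => Re (z u)) t) +i* (conv g (fun u => Im (z u)) t).
Proof.
move=> gi ez; congr (_ +i* _); apply: eq_Rintegral => u _.
  by rewrite ReM/= mul0r subr0.
by rewrite ImM/= mul0r addr0.
Qed.

Section Equation.
Variable g : R -> R.
Hypotheses (g0 : forall u, 0 <= u -> 0 <= g u) (gi : mu.-integrable hl (EFin \o g)).
Hypothesis g1 : \int[mu]_(u in hl) (`|g u| * expR (- u)) < 1.

Lemma cvolterra_exists w : exp_growth w ->
  exists z, exp_growth z /\ forall t, 0 <= t -> z t = w t + cconv (fun u => (g u)%:C) z t.
Proof.
move=> [crw ciw [B wB]].
have [x [cx [Cx xC] xE]] := volterra_exists gi g1 crw (fun t ht => (wB t ht).1).
have [y [cy [Cy yC] yE]] := volterra_exists gi g1 ciw (fun t ht => (wB t ht).2).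
have ez : exp_growth (fun t => x t +i* y t).
  split=> //; exists (Num.max Cx Cy) => t t0; split.
    by apply: le_trans (xC t t0) _; rewrite ler_wpM2r ?expR_ge0// le_max lexx.
  by apply: le_trans (yC t t0) _; rewrite ler_wpM2r ?expR_ge0// le_max lexx orbT.
exists (fun t => x t +i* y t); split => // t t0.
rewrite cconv_realE//= (xE t t0) (yE t t0).
by case: (w t).
Qed.

(** As g is real, the equation splits. The real part falls under the real comparison lemma; the
    imaginary part solves the homogeneous equation, and comparison for both signs makes it 0. *)
Lemma cvolterra_ge0 z : exp_growth z ->
  (forall t, 0 <= t -> 0 <= z t - cconv (fun u => (g u)%:C) z t) ->
  forall t, 0 <= t -> 0 <= z t.
Proof.
move=> ez zg t t0; case: (ez) => crz ciz [B zB].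
have zg' u : 0 <= u -> conv g (fun u => Im (z u)) u = Im (z u) /\
    conv g (fun u => Re (z u)) u <= Re (z u).
  move=> /zg; rewrite cconv_realE//; case: (z u) => a b.
  rewrite lecE/= => /andP[/eqP e1 e2]; split; [lra|].
  by move: e2; rewrite subr_ge0.
rewrite lecE/=; apply/andP; split; last first.
  apply: (volterra_ge0 gi g0 g1 crz (fun t ht => (zB t ht).1)) => // u u0.
  exact: (zg' u u0).2.
rewrite eq_le; apply/andP; split; last first.
  apply: (volterra_ge0 gi g0 g1 ciz (fun t ht => (zB t ht).2)) => // u u0.
  by rewrite (zg' u u0).1.
rewrite -oppr_ge0.
apply: (@volterra_ge0 _ g (fun u => - Im (z u)) B) => //.
- by move=> u; apply: cvgN; exact: ciz.
- by move=> u u0; rewrite normrN; exact: (zB u u0).2.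
- move=> u u0; rewrite -(zg' u u0).1 /conv -mulN1r -RintegralZl//.
    rewrite le_eqVlt; apply/orP; left; apply/eqP.
    by apply: eq_Rintegral => v _; rewrite mulrN mulN1r.
  exact: (conv_integrable ciz (integrable_halflineS u gi)).
Qed.

End Equation.

Lemma cconvZr h z c t : cintegrable hl h -> exp_growth z ->
  cconv h (fun u => c * z u) t = c * cconv h z t.
Proof.
move=> ih ez; rewrite /cconv -cintZ//; last exact: cconv_integrable.
by apply: eq_cint => u _; rewrite mulrCA.
Qed.

Lemma cconvDr h z w t : cintegrable hl h -> exp_growth z -> exp_growth w ->
  cconv h (fun u => z u + w u) t = cconv h z t + cconv h w t.
Proof.
move=> ih ez ew; rewrite /cconv -cintD//; [|exact: cconv_integrable..].
by apply: eq_cint => u _; rewrite mulrDr.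
Qed.

Lemma cconv_sumr h (I : Type) (r : seq I) (z : I -> R -> C) t :
  cintegrable hl h -> (forall i, exp_growth (z i)) ->
  cconv h (fun u => \sum_(i <- r) z i u) t = \sum_(i <- r) cconv h (z i) t.
Proof.
move=> ih ez; rewrite /cconv -cint_sum//; last by move=> i; exact: cconv_integrable.
by apply: eq_cint => u _; rewrite mulr_sumr.
Qed.

Lemma eq_cconvl h k z t : (forall u, 0 <= u -> h u = k u) -> cconv h z t = cconv k z t.
Proof. by move=> hk; apply: eq_cint => u /=; rewrite in_itv/= => /andP[/hk ->]. Qed.

Lemma claplaceD z w s :
  cintegrable hl (fun t => (expR (- (s * t)))%:C * z t) ->
  cintegrable hl (fun t => (expR (- (s * t)))%:C * w t) ->
  claplace (fun t => z t + w t) s = claplace z s + claplace w s.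
Proof.
move=> iz iw; rewrite /claplace -cintD//; last exact: measurable_halfline.
by apply: eq_cint => t _; rewrite mulrDr.
Qed.

Lemma claplaceZ z c s :
  cintegrable hl (fun t => (expR (- (s * t)))%:C * z t) ->
  claplace (fun t => z t * c) s = claplace z s * c.
Proof.
move=> iz; rewrite /claplace mulrC -cintZ//; last exact: measurable_halfline.
by apply: eq_cint => t _; rewrite mulrA mulrC.
Qed.

Lemma eq_claplace z w s : (forall t, 0 <= t -> z t = w t) -> claplace z s = claplace w s.
Proof.
move=> zw; apply: eq_cint => t; rewrite /halfline/= in_itv/= andbT => t0.
by rewrite zw.
Qed.

(** Meant for the kernel tr(F_t a), which is integrable without a growth bound: the weight is at
    most 1 on the half-line. *)
Lemma cintegrable_claplace h s : 0 < s -> cintegrable hl h ->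
  cintegrable hl (fun t => (expR (- (s * t)))%:C * h t).
Proof.
move=> s0 [rh ih]; have mhl := @measurable_halfline R.
have key (k : R -> R) : mu.-integrable hl (EFin \o k) ->
    mu.-integrable hl (EFin \o (fun t => k t * expR (- (s * t)))).
  move=> ik; apply: (@integrable_mul_bounded _ _ _ _ 1) => //.
    apply: measurable_funTS; apply: continuous_measurable_fun.
    exact: continuous_expRN.
  move=> t; rewrite /halfline/= in_itv/= andbT => t0.
  by rewrite ger0_norm ?expR_ge0// expR_le1// oppr_le0 mulr_ge0// ltW.
split.
  by have := key _ rh; apply: eq_integrable => // t _ /=; rewrite ReM/= mul0r subr0 mulrC.
by have := key _ ih; apply: eq_integrable => // t _ /=; rewrite ImM/= mul0r addr0 mulrC.
Qed.

End ComplexVolterra.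

(** * Integrals, Laplace transforms and inverses of superoperators *)

Section MapIntegral.
Local Open Scope complex_scope.
Variables (R : realType) (n : nat).
Local Notation hl := (@halfline R).
Local Notation C := R[i].
Implicit Types (A : R -> superop R n) (s t : R).

Lemma completely_positiveD (K L : superop R n) :
  completely_positive K -> completely_positive L -> completely_positive (K + L).
Proof.
move=> /completely_positiveP cK /completely_positiveP cL.
apply/completely_positiveP => k A pA v.
under eq_bigr do under eq_bigr do
  rewrite lfunE/= /sform mulmxDr mulmxDl mxE -/(sform _ _ _) -/(sform _ (L _) _).
under eq_bigr do rewrite big_split/=.
by rewrite big_split/= addr_ge0 ?cK ?cL.
Qed.

(** For fixed test vectors the block form is a finite combination of entries, so it commutes with
    the integral and has a nonnegative integrand. *)
Lemma map_integral_completely_positive (D : set R) A :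
  measurable (D : set (measurableTypeR R)) -> map_integrable D A ->
  (forall t, D t -> completely_positive (A t)) -> completely_positive (map_integral D A).
Proof.
move=> mD iA cA; apply/completely_positiveP => k X pX v.
have iE a i j c d : cintegrable D (fun t => c * A t a i j * d).
  apply: (eq_cintegrable (z := fun t => (c * d) * A t a i j)) => // [t _|].
    by rewrite mulrAC.
  by apply: cintegrableZ => //; exact: iA.
have E i j : sform (v i) (map_integral D A (submxblock X i j)) (v j) =
    cint D (fun t => sform (v i) (A t (submxblock X i j)) (v j)).
  rewrite sformE; transitivity (cint D (fun t => \sum_k \sum_l
      (v i k 0)^*%C * A t (submxblock X i j) k l * v j l 0)).
    rewrite cint_sum//; last by move=> a; apply: cintegrable_sum.
    apply: eq_bigr => a _; rewrite cint_sum//; apply: eq_bigr => b _.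
    rewrite map_integralE//.
    rewrite -/(cint D (fun t => A t (submxblock X i j) a b)) mulrAC.
    rewrite -(cintZ mD _ (iA _ a b)).
    by apply: eq_cint => t _; rewrite mulrAC.
  by apply: eq_cint => t _; rewrite sformE.
have iS i j : cintegrable D (fun t => sform (v i) (A t (submxblock X i j)) (v j)).
  apply: (eq_cintegrable (z := fun t => \sum_k \sum_l
      (v i k 0)^*%C * A t (submxblock X i j) k l * v j l 0)) => // [t _|].
    by rewrite sformE.
  by apply: cintegrable_sum => // a; apply: cintegrable_sum.
under eq_bigr do under eq_bigr do rewrite E.
under eq_bigr do rewrite -cint_sum//.
rewrite -cint_sum//; last by move=> i; exact: cintegrable_sum.
apply: cint_ge0 => // t Dt.
by move: (cA t Dt) => /completely_positiveP; apply.
Qed.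

Lemma laplace_convergesP A s :
  (forall a i j, cintegrable hl (fun t => (expR (- (s * t)))%:C * A t a i j)) ->
  laplace_converges A s.
Proof.
move=> iA a i j; have [ra ia] := iA a i j; split.
  by apply: eq_integrable ra => // [|t _]; [exact: measurable_halfline|rewrite /= lfunE/= mxE].
by apply: eq_integrable ia => // [|t _]; [exact: measurable_halfline|rewrite /= lfunE/= mxE].
Qed.

Lemma laplaceE A s a i j : laplace_converges A s ->
  laplace A s a i j = claplace (fun t => A t a i j) s.
Proof.
move=> cA; rewrite /laplace map_integralE//; last exact: measurable_halfline.
by congr (_ +i* _); apply: eq_Rintegral => t _; rewrite lfunE/= mxE.
Qed.

(** If L x = 0, then x = -(L - 1) x, so each entry of x is at most e S, where S is the sum of the
    moduli of the entries. Summing gives S <= n^2 e S, hence S = 0. *)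
Lemma lker0_near_id (L : superop R n) (e : C) :
  (forall k l i j, `|L (delta_mx k l) i j - (delta_mx k l : 'M[C]_n) i j| <= e) ->
  (n * n)%:R * e < 1 -> lker L == 0%VS.
Proof.
move=> Le e1; rewrite -subv0; apply/subvP => x; rewrite memv_ker memv0 => /eqP Lx.
pose S := \sum_k \sum_l `|x k l|.
have xS i j : `|x i j| <= e * S.
  have -> : x i j = - \sum_k \sum_l x k l *
      (L (delta_mx k l) i j - (delta_mx k l : 'M[C]_n) i j).
    transitivity (- (L x - x) i j); first by rewrite Lx !mxE sub0r opprK.
    congr (- _); rewrite {1 2}(matrix_sum_delta x) linear_sum -sumrB summxE.
    apply: eq_bigr => k _; rewrite linear_sum -sumrB summxE.
    by apply: eq_bigr => l _; rewrite linearZ/= -scalerBr mxE [in LHS]mxE [X in _ * (_ + X)]mxE.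
  rewrite normrN (le_trans (ler_norm_sum _ _ _))// /S mulr_sumr ler_sum// => k _.
  rewrite (le_trans (ler_norm_sum _ _ _))// mulr_sumr ler_sum// => l _.
  by rewrite normrM mulrC ler_wpM2r.
have S0 : 0 <= S by rewrite sumr_ge0// => k _; rewrite sumr_ge0.
have Sle : S <= (n * n)%:R * e * S.
  apply: (@le_trans _ _ (\sum_(k < n) \sum_(l < n) e * S)).
    by rewrite ler_sum// => k _; rewrite ler_sum.
  by rewrite !sumr_const !card_ord -mulrnA -mulrA mulr_natl.
have {}Sle : S <= 0.
  rewrite -(@pmulr_lle0 _ (1 - (n * n)%:R * e)) ?subr_gt0//.
  by rewrite mulrBr mulr1 mulrC subr_le0.
have /eqP : S = 0 by apply/eqP; rewrite eq_le Sle.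
rewrite psumr_eq0 => [/allP Sk|k _]; last exact: sumr_ge0.
apply/eqP/matrixP => i j; rewrite [RHS]mxE; apply/eqP.
have := Sk i (mem_index_enum _); rewrite psumr_eq0// => /allP/(_ j (mem_index_enum _)).
by rewrite normr_eq0.
Qed.

(** The rank-one structure in the Laplace domain: Y(a - h(a) w) = Y a - h(a) Y w, so knowing Y up to
    its value at w is enough. *)
Lemma lfun_comp_id_sub_rank1 (X Y Z : superop R n) (h : 'M[C]_n -> C) (w : 'M[C]_n) :
  (forall a, Z a = h a *: w) -> (forall a, Y a = X a + h a *: Y w) ->
  (Y \o (\1 - Z))%VF = X.
Proof.
move=> ZE YE; apply/lfunP => a; rewrite comp_lfunE add_lfunE opp_lfunE id_lfunE ZE.
by rewrite linearB linearZ/= YE addrK.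
Qed.

(** The kernel is designed so that c - K = (1 - Z) X^-1. Hence Y is a left inverse of c - K, which
    is then injective and, in finite dimension, invertible with inverse Y. *)
Lemma resolvent_inverse (X Y Z : superop R n) :
  lker X == 0%VS -> (Y \o (\1 - Z))%VF = X -> forall c : C,
  let K := ((Z - (\1 - c *: X)) \o X^-1)%VF in
  lker (c *: \1 - K)%VF == 0%VS /\ Y = ((c *: \1 - K)^-1)%VF.
Proof.
move=> iX YZ c K.
have KE : (c *: \1 - K = (\1 - Z) \o X^-1)%VF.
  have -> : (c *: \1 = (c *: X) \o X^-1)%VF.
    by rewrite -comp_lfunZl lker0_compfV.
  rewrite /K -comp_lfunNl -comp_lfunDl; congr (_ \o _)%VF.
  by rewrite !opprD !opprK addrCA [c *: X + _]addrC addrNK addrC.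
have inv : (Y \o (c *: \1 - K) = \1)%VF.
  by rewrite KE comp_lfunA YZ lker0_compfV.
move: (c *: \1 - K)%VF inv => T inv.
have ker0 : lker T == 0%VS.
  rewrite -subv0; apply/subvP => a; rewrite memv_ker memv0 => /eqP Ta.
  by rewrite -[a]id_lfunE -inv comp_lfunE Ta linear0.
split => //.
by rewrite -[LHS]comp_lfun1r -(lker0_compfV ker0) comp_lfunA inv comp_lfun1l.
Qed.

End MapIntegral.

(** * The dynamical map built from N and F *)

Section Dynamics.
Local Open Scope complex_scope.
Variables (R : realType) (n : nat) (N F : R -> superop R n).
Hypotheses
  (N_cp : forall t, 0 <= t -> completely_positive (N t))
  (N_int : forall t, 0 <= t ->
     map_integrable `[0, t]%classic F /\
     N t = \1%VF - map_integral `[0, t]%classic F)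
  (F_pos : forall t, 0 <= t -> psd (dual (F t) 1%:M)).
Local Notation mu := (@lebesgue_measure R).
Local Notation hl := (@halfline R).
Local Notation C := R[i].
Local Notation Re := (@complex.Re R).
Local Notation Im := (@complex.Im R).
Implicit Types (a : 'M[C]_n) (t s u : R).

Let f a t : C := \tr (F t a).

Lemma entryN t a i j : 0 <= t ->
  N t a i j = a i j - cint `[0, t] (fun u => F u a i j).
Proof.
move=> t0; have [iF ->] := N_int t0.
by rewrite add_lfunE opp_lfunE id_lfunE mxE [X in _ + X]mxE map_integralE.
Qed.

Lemma cintegrableF t a i j : 0 <= t -> cintegrable `[0, t] (fun u => F u a i j).
Proof. by move=> t0; have [iF _] := N_int t0; exact: (iF a i j). Qed.

Lemma cintegrable_trF t a : 0 <= t -> cintegrable `[0, t] (f a).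
Proof. by move=> t0; apply: cintegrable_sum => // i; exact: cintegrableF. Qed.

Lemma mxtraceN t a : 0 <= t -> \tr (N t a) = \tr a - cint `[0, t] (f a).
Proof.
move=> t0; rewrite /f /mxtrace cint_sum//; last by move=> i; exact: cintegrableF.
by rewrite -sumrB; apply: eq_bigr => i _; rewrite entryN.
Qed.

Lemma trF_ge0 t a : 0 <= t -> psd a -> 0 <= f a t.
Proof. by move=> t0 pa; rewrite /f -mxtrace_dual1 mxtrace_psd_ge0//; exact: F_pos. Qed.

Lemma mxtraceN_le t a : 0 <= t -> psd a -> \tr (N t a) <= \tr a.
Proof.
move=> t0 pa; rewrite mxtraceN// gerBl; apply: cint_ge0 => // u.
by rewrite /= in_itv/= => /andP[u0 _]; exact: trF_ge0.
Qed.

(** For psd a the entries of N_t(a) are at most tr N_t(a) <= tr a, uniformly in t; linearity does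
    the rest. *)
Lemma N_bounded a : exists B : C, forall t i j, 0 <= t -> `|N t a i j| <= B.
Proof.
elim/psd_ind: a => [a pa|c a b [B aB] [B' bB']].
  exists (\tr a) => t i j t0; apply: le_trans (mxtraceN_le t0 pa).
  by apply: psd_entry_le; exact: completely_positive_psd (N_cp t0) pa.
exists (`|c| * B + B') => t i j t0; rewrite linearP !mxE.
rewrite (le_trans (ler_normD _ _))// normrM lerD ?ler_wpM2l ?aB ?bB'//.
Qed.

Lemma N_bounded_real a : exists2 B : R, 0 <= B & forall t i j, 0 <= t ->
  `|Re (N t a i j)| <= B /\ `|Im (N t a i j)| <= B.
Proof.
have [B aB] := N_bounded a; exists `|Re B| => // t i j t0.
have h (z : C) : `|z| <= B -> `|Re z| <= `|Re B|.
  move=> zB; have := le_trans (normc_ge_Re z) zB; rewrite lecE/= => /andP[_].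
  by move=> /le_trans; apply; exact: ler_norm.
split; first by apply: h; exact: aB.
have := h (N t a i j * 'i%C); rewrite ReiNIm normrN; apply.
rewrite normrM (_ : `|'i%C| = 1) ?mulr1 ?aB//.
by rewrite normc_def/= expr0n/= add0r expr1n sqrtr1.
Qed.

Let Nmax t := N (Num.max t 0).
Let m0 t : 0 <= Num.max t 0 :> R. Proof. by rewrite le_max lexx orbT. Qed.
Let mE t : 0 <= t -> Num.max t 0 = t. Proof. by move=> t0; rewrite max_l. Qed.

Lemma exp_growth_N a i j : exp_growth (fun t => Nmax t a i j).
Proof.
have [B B0 aB] := N_bounded_real a; split.
- rewrite (_ : (fun t => _) = (fun t => Re (a i j) -
      \int[mu]_(u in `[0, Num.max t 0]) Re (F u a i j))); last first.
    by apply/funext => t; rewrite /Nmax entryN//; case: (a i j).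
  move=> t; apply: cvgB; first exact: cvg_cst.
  by apply: continuous_integral_max0 => z z0; exact: (cintegrableF a i j z0).1.
- rewrite (_ : (fun t => _) = (fun t => Im (a i j) -
      \int[mu]_(u in `[0, Num.max t 0]) Im (F u a i j))); last first.
    by apply/funext => t; rewrite /Nmax entryN//; case: (a i j).
  move=> t; apply: cvgB; first exact: cvg_cst.
  by apply: continuous_integral_max0 => z z0; exact: (cintegrableF a i j z0).2.
- exists B => t t0; rewrite /Nmax mE//; have [rB iB] := aB t i j t0.
  have BE : B <= B * expR t by rewrite ler_peMr// -expR0 ler_expR.
  by split; [exact: le_trans rB _|exact: le_trans iB _].
Qed.

(** Positivity of N_t gives tr N_t(a) >= 0, so the nonnegative function tr(F_u a) has integral at
    most tr a over every [0, t]. *)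
Lemma psd_trF_halfline a : psd a ->
  mu.-integrable hl (EFin \o (fun t => Re (f a t))) /\
  \int[mu]_(t in hl) Re (f a t) <= Re (\tr a).
Proof.
move=> pa; apply: integrable_halfline => t t0.
- by have := trF_ge0 t0 pa; rewrite lecE => /andP[].
- exact: (cintegrable_trF a t0).1.
- have : 0 <= \tr (N t a).
    by apply: psd_mxtrace_ge0; exact: completely_positive_psd (N_cp t0) pa.
  rewrite mxtraceN// subr_ge0 lecE => /andP[_]; exact.
Qed.

Lemma cintegrable_trF_halfline a : cintegrable hl (f a).
Proof.
have mhl := @measurable_halfline R.
elim/psd_ind: a => [a pa|c a b ia ib].
  split; first exact: (psd_trF_halfline pa).1.
  apply: (@eq_integrable _ _ _ mu hl mhl (cst 0%E)); last exact: integrable0.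
  move=> t; rewrite inE /halfline/= in_itv/= andbT => t0.
  by rewrite (ger0_Im (trF_ge0 t0 pa)).
apply: (eq_cintegrable (z := fun t => c * f a t + f b t)) => // [t _|].
  by rewrite /f linearP/= mxtraceD mxtraceZ.
by apply: cintegrableD => //; exact: cintegrableZ.
Qed.

(** What matters is that w is psd of trace 1. The trace condition fails for n = 0, where all
    matrices are empty; that case is split off wherever it arises. *)
Let w : 'M[C]_n := (n%:R^-1)%:M.

Lemma psd_maximally_mixed : psd w.
Proof.
move=> v; rewrite -/(sform v w v) /sform mul_mx_scalar -scalemxAl mxE.
rewrite mulr_ge0 ?invr_ge0 ?ler0n// mxE sumr_ge0// => i _.
by rewrite !mxE mulrC mulcJ_ge0.
Qed.

Lemma mxtrace_maximally_mixed : (0 < n)%N -> \tr w = 1.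
Proof. by move=> n0; rewrite mxtrace_scalar -[LHS]mulr_natl mulfV// pnatr_eq0 -lt0n. Qed.

Let g t := Re (f w t).

Lemma trF_mixed t : 0 <= t -> f w t = (g t)%:C.
Proof.
by move=> t0; rewrite /g [LHS]complexE (ger0_Im (trF_ge0 t0 psd_maximally_mixed)) mulr0 addr0.
Qed.

Lemma g_ge0 t : 0 <= t -> 0 <= g t.
Proof. by move=> t0; have := trF_ge0 t0 psd_maximally_mixed; rewrite lecE => /andP[]. Qed.

Lemma g_integrable : mu.-integrable hl (EFin \o g).
Proof. exact: (psd_trF_halfline psd_maximally_mixed).1. Qed.

Lemma g_lt1 : \int[mu]_(u in hl) (`|g u| * expR (- u)) < 1.
Proof.
apply: laplace1_lt1; [exact: g_ge0|exact: g_integrable|].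
apply: le_trans (psd_trF_halfline psd_maximally_mixed).2 _.
have [n0|n0] := posnP n.
  by rewrite /mxtrace big1// => i; have := ltn_ord i; rewrite {2}n0.
by rewrite mxtrace_maximally_mixed.
Qed.

(** The unknown is a matrix but the kernel is a scalar, so the equation decouples into independent
    equations for the entries. *)
Lemma renewal_exists : exists M : R -> 'M[C]_n,
  (forall i j, exp_growth (fun t => M t i j)) /\
  forall t i j, 0 <= t ->
    M t i j = N t w i j + cconv (f w) (fun u => M u i j) t.
Proof.
have ex (ij : 'I_n * 'I_n) : exists z, exp_growth z /\ forall t, 0 <= t ->
    z t = Nmax t w ij.1 ij.2 + cconv (fun u => (g u)%:C) z t.
  by apply: cvolterra_exists; [exact: g_integrable|exact: g_lt1|exact: exp_growth_N].
have [M MP] := choice ex.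
exists (fun t => \matrix_(i, j) M (i, j) t); split => [i j|t i j t0].
  rewrite (_ : (fun t => _) = M (i, j)); first exact: (MP _).1.
  by apply/funext => t; rewrite mxE.
rewrite mxE ((MP _).2 t t0)/= /Nmax mE//; congr (_ + _).
apply: eq_cint => u /=; rewrite in_itv/= => /andP[u0 _].
by rewrite trF_mixed// mxE.
Qed.

Section Solution.
Variable M : R -> 'M[C]_n.
Hypotheses (M_exp_growth : forall i j, exp_growth (fun t => M t i j))
  (M_eq : forall t i j, 0 <= t ->
    M t i j = N t w i j + cconv (f w) (fun u => M u i j) t).

Lemma renewal_mixed (z : R -> C) t :
  cconv (f w) z t = cconv (fun u => (g u)%:C) z t.
Proof. by apply: eq_cconvl => u; exact: trF_mixed. Qed.

(** For fixed v the form of M_t at v solves the scalar renewal equation whose datum is the form of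
    N_t(w), which is nonnegative; scalar comparison then applies. *)
Lemma renewal_psd t : 0 <= t -> psd (M t).
Proof.
move=> t0 v; rewrite -/(sform v (M t) v).
have sE (A : R -> 'M[C]_n) u : sform v (A u) v =
    \sum_i \sum_j ((v i 0)^*%C * v j 0) * A u i j.
  by rewrite sformE; apply: eq_bigr => i _; apply: eq_bigr => j _; rewrite mulrAC.
have ez : exp_growth (fun t => sform v (M t) v).
  rewrite (_ : (fun t => _) = fun t => \sum_i \sum_j ((v i 0)^*%C * v j 0) * M t i j).
    by apply: exp_growth_sum => i; apply: exp_growth_sum => j; exact: exp_growthZ.
  by apply/funext => u; rewrite sE.
apply: (cvolterra_ge0 g_ge0 g_integrable g_lt1 ez) => // u u0.
have -> : sform v (M u) v - cconv (fun u => (g u)%:C) (fun u => sform v (M u) v) u =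
    sform v (N u w) v.
  apply/eqP; rewrite subr_eq; apply/eqP.
  rewrite sE (sE (fun t => N t w)) -renewal_mixed.
  have -> : cconv (f w) (fun u => sform v (M u) v) u =
      \sum_i \sum_j ((v i 0)^*%C * v j 0) * cconv (f w) (fun u => M u i j) u.
    rewrite (_ : (fun u => _) = fun u => \sum_i \sum_j ((v i 0)^*%C * v j 0) * M u i j).
      rewrite cconv_sumr//; last first.
      - by move=> i; apply: exp_growth_sum => j; exact: exp_growthZ.
      - exact: cintegrable_trF_halfline.
      apply: eq_bigr => i _; rewrite cconv_sumr//; last first.
      - by move=> j; exact: exp_growthZ.
      - exact: cintegrable_trF_halfline.
      by apply: eq_bigr => j _; rewrite cconvZr//; exact: cintegrable_trF_halfline.
    by apply/funext => z; rewrite sE.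
  rewrite -big_split; apply: eq_bigr => i _; rewrite -big_split; apply: eq_bigr => j _.
  by rewrite /= -mulrDr M_eq.
exact: (completely_positive_psd (N_cp u0) psd_maximally_mixed v).
Qed.

(** Since tr N_t(w) = 1 minus the integral of g over [0, t], the constant 1 solves the traced
    equation. The difference tr M - 1 solves the homogeneous one, and comparison for c = 1 and c =
    -1 makes it 0. *)
Lemma renewal_trace t : (0 < n)%N -> 0 <= t -> \tr (M t) = 1.
Proof.
move=> n0 t0; have ifw := cintegrable_trF_halfline w.
have eT : exp_growth (fun u => \tr (M u)) by apply: exp_growth_sum => i; exact: M_exp_growth.
have e1 : exp_growth (fun u => \tr (M u) - 1) by apply: exp_growthD => //; exact: exp_growth_cst.
have tM u : 0 <= u -> \tr (M u) = \tr (N u w) + cconv (f w) (fun v => \tr (M v)) u.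
  move=> u0; rewrite cconv_sumr// /mxtrace -big_split.
  by apply: eq_bigr => i _; exact: M_eq.
have zE c u : 0 <= u -> c * (\tr (M u) - 1) -
    cconv (fun v => (g v)%:C) (fun v => c * (\tr (M v) - 1)) u = 0.
  move=> u0; rewrite -renewal_mixed cconvZr// -mulrBr.
  suff -> : cconv (f w) (fun v => \tr (M v) - 1) u = \tr (M u) - 1 by rewrite subrr mulr0.
  have -> : cconv (f w) (fun v => \tr (M v) - 1) u =
      cconv (f w) (fun v => \tr (M v)) u - cint `[0, u] (f w).
    rewrite cconvDr//; last exact: exp_growth_cst.
    congr (_ + _); rewrite /cconv -[RHS]mulN1r -cintZ//.
      by apply: eq_cint => v _; rewrite mulrC.
    exact: cintegrable_halflineS.
  by rewrite (tM u u0) mxtraceN// mxtrace_maximally_mixed//; ring.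
have ge0 c : 0 <= c * (\tr (M t) - 1).
  apply: (cvolterra_ge0 g_ge0 g_integrable g_lt1 (exp_growthZ c e1)) => // u u0.
  by rewrite zE.
by apply/eqP; rewrite -subr_eq0 eq_le -oppr_ge0 -mulN1r -{2}[_ - 1]mul1r !ge0.
Qed.

(** An integral of measure-and-prepare maps rather than an entrywise convolution, so that complete
    positivity can be read off the integrand. *)
Let Lam t := N t + map_integral `[0, t] (fun u => measure_prepare (dual (F u) 1%:M) (M (t - u))).

Lemma measure_prepare_entry u (W : 'M[C]_n) a i j :
  measure_prepare (dual (F u) 1%:M) W a i j = f a u * W i j.
Proof. by rewrite measure_prepareE mxE mxtrace_dual1. Qed.

Lemma solution_integrable t :
  map_integrable `[0, t] (fun u => measure_prepare (dual (F u) 1%:M) (M (t - u))).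
Proof.
move=> a i j.
suff : cintegrable `[0, t] (fun u => measure_prepare (dual (F u) 1%:M) (M (t - u)) a i j) by [].
apply: eq_cintegrable (cconv_integrable (cintegrable_trF_halfline a) (M_exp_growth i j) t) => //.
by move=> u _; rewrite measure_prepare_entry.
Qed.

Lemma entryLam t a i j :
  Lam t a i j = N t a i j + cconv (f a) (fun u => M u i j) t.
Proof.
rewrite add_lfunE mxE map_integralE//; last exact: solution_integrable.
by congr (_ + _); apply: eq_cint => u _; rewrite measure_prepare_entry.
Qed.

Lemma Lam_completely_positive t : 0 <= t -> completely_positive (Lam t).
Proof.
move=> t0; apply: completely_positiveD; first exact: N_cp.
apply: map_integral_completely_positive => //; first exact: solution_integrable.
move=> u; rewrite /= in_itv/= => /andP[u0 ut].
apply: measure_prepare_completely_positive; first exact: F_pos.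
by apply: renewal_psd; rewrite subr_ge0.
Qed.

(** The trace lost by N_t, the integral of tr(F_u a) over [0, t], is exactly what the convolution
    restores, because tr M = 1. *)
Lemma Lam_trace_preserving t : 0 <= t -> trace_preserving (Lam t).
Proof.
move=> t0 a; have [n0|n0] := posnP n.
  by rewrite /mxtrace !big1// => i; have := ltn_ord i; rewrite {2}n0.
transitivity (\tr (N t a) + cconv (f a) (fun u => \tr (M u)) t).
  rewrite cconv_sumr//; last exact: cintegrable_trF_halfline.
  by rewrite /mxtrace -big_split; apply: eq_bigr => i _; rewrite entryLam.
rewrite mxtraceN// [cconv _ _ _](_ : _ = cint `[0, t] (f a)) ?subrK//.
apply: eq_cint => u; rewrite /= in_itv/= => /andP[u0 ut].
by rewrite renewal_trace ?mulr1// subr_ge0.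
Qed.

(** Closes the loop: the auxiliary solution M is Lam(w), so convolving with M amounts to convolving
    Lam with Q. *)
Lemma Lam_mixed t : 0 <= t -> Lam t w = M t.
Proof. by move=> t0; apply/matrixP => i j; rewrite entryLam -M_eq. Qed.

Lemma Lam0 : Lam 0 = \1%VF.
Proof.
have c0 (z : R -> C) : cint `[0, 0] z = 0 by rewrite /cint set_itv1 !Rintegral_set1.
apply/lfunP => a; apply/matrixP => i j.
by rewrite entryLam entryN// id_lfunE /cconv !c0 subr0 addr0.
Qed.

Lemma exp_growth_Lam a i j : exp_growth (fun t => Lam (Num.max t 0) a i j).
Proof.
rewrite (_ : (fun t => _) = fun t => Nmax t a i j +
    cconv (f a) (fun u => M u i j) (Num.max t 0)); last first.
  by apply/funext => t; rewrite entryLam.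
apply: exp_growthD; first exact: exp_growth_N.
by apply: exp_growth_cconv => //; exact: cintegrable_trF_halfline.
Qed.

Let Q t := measure_prepare (dual (F t) 1%:M) w.

Lemma laplace_converges_N s : 1 < s -> laplace_converges N s.
Proof.
move=> s1; apply: laplace_convergesP => a i j.
apply: eq_cintegrable (claplace_integrable s1 (exp_growth_N a i j)); first exact: measurable_halfline.
by move=> t; rewrite /halfline/= in_itv/= andbT => t0; rewrite /Nmax mE.
Qed.

Lemma laplace_converges_Lam s : 1 < s -> laplace_converges Lam s.
Proof.
move=> s1; apply: laplace_convergesP => a i j.
apply: eq_cintegrable (claplace_integrable s1 (exp_growth_Lam a i j)); first exact: measurable_halfline.
by move=> t; rewrite /halfline/= in_itv/= andbT => t0; rewrite mE.
Qed.

Lemma laplace_converges_Q s : 0 < s -> laplace_converges Q s.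
Proof.
have mhl := @measurable_halfline R.
move=> s0; apply: laplace_convergesP => a i j.
apply: eq_cintegrable (cintegrableZ mhl (w i j)
  (cintegrable_claplace s0 (cintegrable_trF_halfline a))) => //.
by move=> t _; rewrite measure_prepare_entry mulrC mulrA.
Qed.

Lemma laplace_Q s a : 0 < s -> laplace Q s a = claplace (f a) s *: w.
Proof.
move=> s0; apply/matrixP => i j; rewrite [RHS]mxE laplaceE; last exact: laplace_converges_Q.
rewrite -claplaceZ; last exact: cintegrable_claplace (cintegrable_trF_halfline a).
by apply: eq_claplace => t _; exact: measure_prepare_entry.
Qed.

(** The convolution theorem applied to each entry, with M replaced by Lam(w) so that only Lam itself
    remains. *)
Lemma laplace_Lam s a : 1 < s ->
  laplace Lam s a = laplace N s a + claplace (f a) s *: laplace Lam s w.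
Proof.
move=> s1; have cLam := laplace_converges_Lam s1.
have icc i j : exp_growth (fun t => cconv (f a) (fun u => M u i j) (Num.max t 0)).
  by apply: exp_growth_cconv => //; exact: cintegrable_trF_halfline.
apply/matrixP => i j; rewrite mxE [X in _ + X]mxE.
transitivity (claplace (fun t => Lam t a i j) s); first exact: laplaceE.
transitivity (claplace (fun t => N t a i j) s +
    claplace (f a) s * claplace (fun t => Lam t w i j) s); last first.
  congr (_ + _ * _); apply/esym; last exact: laplaceE.
  by apply: laplaceE; exact: laplace_converges_N.
rewrite (@eq_claplace _ _ (fun t => Nmax t a i j +
    cconv (f a) (fun u => M u i j) (Num.max t 0))); last first.
  by move=> t t0; rewrite entryLam /Nmax mE.
rewrite claplaceD; [|exact: claplace_integrable s1 (exp_growth_N a i j)|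
  exact: claplace_integrable s1 (icc i j)].
congr (_ + _); first by apply: eq_claplace => t t0; rewrite /Nmax mE.
rewrite (@eq_claplace _ (fun t => Lam t w i j) (fun t => M t i j)); last first.
  by move=> t t0; rewrite Lam_mixed.
transitivity (claplace (cconv (f a) (fun u => M u i j)) s).
  by apply: eq_claplace => t t0; rewrite mE.
exact: (claplace_conv (cintegrable_trF_halfline a) (M_exp_growth i j) s1).
Qed.

Lemma laplace_Lam_Q s : 1 < s ->
  (laplace Lam s \o (\1 - laplace Q s) = laplace N s)%VF.
Proof.
move=> s1; have s0 : 0 < s by rewrite (lt_trans _ s1).
exact: (lfun_comp_id_sub_rank1 (fun a => laplace_Q a s0) (fun a => laplace_Lam a s1)).
Qed.

(** As N_0 = 1, the initial value theorem puts s N~_s entrywise close to the identity on the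
    finitely many matrix units, and N~_s has no larger kernel than s N~_s. *)
Lemma laplace_N_invertible : \forall s \near +oo, invertible_map (laplace N s).
Proof.
(* Real and imaginary parts each contribute an error e, so an entry is off by at most 2 e = 1 / (n^2
   + 1), and n^2 times this is below 1. *)
pose e : R := (2 * (n * n).+1%:R)^-1.
have e0 : 0 < e by rewrite invr_gt0 mulr_gt0.
have near_entry (x : 'I_n * 'I_n * ('I_n * 'I_n)) : \forall s \near +oo,
    `|s%:C * claplace (fun t => Nmax t (delta_mx x.1.1 x.1.2) x.2.1 x.2.2) s -
      (delta_mx x.1.1 x.1.2 : 'M[C]_n) x.2.1 x.2.2| <= (e + e)%:C.
  case: x => [[k l] [i j]]/=; set d := delta_mx k l.
  have [crN ciN _] := exp_growth_N d i j.
  have [B B0 bN] := N_bounded_real d.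
  have N0 : Nmax 0 d i j = d i j.
    by rewrite /Nmax mE// entryN// /cint set_itv1 !Rintegral_set1 subr0.
  have rN := initial_value crN (fun t ht => (bN _ i j (m0 t)).1) e0.
  have iN := initial_value ciN (fun t ht => (bN _ i j (m0 t)).2) e0.
  apply: filterS2 rN iN => s; rewrite N0 claplaceE.
  set x := rlaplace _ s; set y := rlaplace _ s; case: (d i j) => a b /= h1 h2.
  have -> : s%:C * (x +i* y) - (a +i* b) = (s * x - a)%:C + 'i%C * (s * y - b)%:C.
    by simpc.
  rewrite (le_trans (ler_normD _ _))// normrM.
  have -> : `|'i%C| = 1 :> C by rewrite normc_def/= expr0n/= add0r expr1n sqrtr1.
  have nR (z : R) : `|z%:C| = `|z|%:C.
    by rewrite normc_def/= expr0n/= addr0 sqrtr_sqr.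
  by rewrite mul1r !nR -rmorphD/= lecR lerD.
near=> s.
have s1 : 1 < s by near: s; exact: nbhs_pinfty_gt.
have Hs : forall x : 'I_n * 'I_n * ('I_n * 'I_n),
    `|s%:C * claplace (fun t => Nmax t (delta_mx x.1.1 x.1.2) x.2.1 x.2.2) s -
      (delta_mx x.1.1 x.1.2 : 'M[C]_n) x.2.1 x.2.2| <= (e + e)%:C.
  by near: s; exact: filter_forall.
rewrite /invertible_map.
have : lker (s%:C *: laplace N s) == 0%VS.
  apply: (@lker0_near_id _ _ _ (e + e)%:C) => [k l i j|].
    suff -> : (s%:C *: laplace N s)%VF (delta_mx k l) i j =
        s%:C * claplace (fun t => Nmax t (delta_mx k l) i j) s.
      exact: (Hs ((k, l), (i, j))).
    rewrite scale_lfunE mxE (laplaceE _ i j (laplace_converges_N s1)); congr (_ * _).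
    by apply: eq_claplace => t t0; rewrite /Nmax mE.
  rewrite -(rmorph_nat (real_complex R)) -rmorphM -(rmorph1 (real_complex R)) ltcR.
  rewrite /e invfM -mulrDl (_ : 2^-1 + 2^-1 = 1 :> R) ?mul1r; last lra.
  by rewrite ltr_pdivrMr// mul1r ltr_nat.
rewrite -!subv0 => /subvP sub; apply/subvP => a; rewrite memv_ker => /eqP Na.
by apply: sub; rewrite memv_ker scale_lfunE Na scaler0.
Unshelve. all: by end_near. Qed.

Lemma renewal_solves_master_equation :
  solves_master_equation (memory_kernel N Q) Lam.
Proof.
split; first exact: Lam0.
near=> s.
have s1 : 1 < s by near: s; exact: nbhs_pinfty_gt.
have iN : invertible_map (laplace N s) by near: s; exact: laplace_N_invertible.
have [kK eK] := resolvent_inverse iN (laplace_Lam_Q s1) (s%:C).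
by split; [exact: laplace_converges_Lam|exact: kK|exact: eK].
Unshelve. all: by end_near. Qed.

End Solution.

Lemma memory_kernel_theorem : exists Q : R -> superop R n,
    [/\ forall t, 0 <= t -> completely_positive (Q t),
        forall t, 0 <= t -> dual (Q t) 1%:M = dual (F t) 1%:M,
        \forall s \near +oo,
          [/\ laplace_converges N s, laplace_converges Q s &
              invertible_map (laplace N s)] &
        legitimate_kernel (memory_kernel N Q)].
Proof.
have [M [eM EM]] := renewal_exists.
exists (fun t => measure_prepare (dual (F t) 1%:M) w); split.
- by move=> t t0; apply: measure_prepare_completely_positive; [exact: F_pos|exact: psd_maximally_mixed].
- move=> t t0; have [n0|n0] := posnP n.
    by apply/matrixP => i; have := ltn_ord i; rewrite {2}n0.
  apply: mxtrace_mul_inj => b.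
  by rewrite !mxtrace_dual1 measure_prepareE mxtraceZ mxtrace_dual1 mxtrace_maximally_mixed ?mulr1.
- near=> s; split.
  + by apply: laplace_converges_N; near: s; exact: nbhs_pinfty_gt.
  + by apply: laplace_converges_Q; near: s; exact: nbhs_pinfty_gt.
  + by near: s; exact: laplace_N_invertible.
- exists (fun t => N t + map_integral `[0, t] (fun u => measure_prepare (dual (F u) 1%:M) (M (t - u)))).
  split.
  + move=> a i j; have [cr ci _] := exp_growth_Lam eM a i j.
    by split; [apply: within_halfline_continuous cr _|apply: within_halfline_continuous ci _]
      => t t0; rewrite mE.
  + move=> t t0; split; [exact: Lam_completely_positive|exact: Lam_trace_preserving].
  + exact: renewal_solves_master_equation.
Unshelve. all: by end_near. Qed.

End Dynamics.

Theorem theorem1 (R : realType) (n : nat) (N F : R -> superop R n)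
  (N_cp : forall t, 0 <= t -> completely_positive (N t))
  (N_deriv : map_has_deriv N (fun t => - F t))
  (N_int : forall t, 0 <= t ->
     map_integrable `[0, t]%classic F /\
     N t = \1%VF - map_integral `[0, t]%classic F)
  (F_pos : forall t, 0 <= t -> psd (dual (F t) 1%:M)) :
  exists Q : R -> superop R n,
    [/\ forall t, 0 <= t -> completely_positive (Q t),
        forall t, 0 <= t -> dual (Q t) 1%:M = dual (F t) 1%:M,
        \forall s \near +oo,
          [/\ laplace_converges N s, laplace_converges Q s &
              invertible_map (laplace N s)] &
        legitimate_kernel (memory_kernel N Q)].
Proof. exact: (memory_kernel_theorem N_cp N_int F_pos). Qed.
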